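(* Let $K$ be an imaginary quadratic field, $f_\rho$ a positive integer, $N=f_\rho|D_K|$ and $\underline{\mathfrak c}=f_\rho\sqrt{D_K}\,\mathcal O_K$. Let $\chi$ be a character of $(\mathcal O_K/\underline{\mathfrak c})^\times$ with $\chi(u)=u$ for all $u\in\mathcal O_K^\times$. Let $\mathfrak c_f$ be an integral ideal of $\mathcal O_K$ dividing $\underline{\mathfrak c}$, and let $\varphi$ be a Hecke character of $K$ of infinity type $[-1/2;1,0]$ with conductor $\mathfrak c_f$ whose finite character $\chi'_\varphi$, pulled back to $(\mathcal O_K/\underline{\mathfrak c})^\times$, equals $\chi^{-1}$. Then $\vartheta(\tau;\varphi)\in F^{\chi^{-1}}(f_\rho)$. Moreover $\vartheta(\tau;\varphi)$ is a linear combination of the functions $f_a(\tau;\beta)$ ($a=1,\dots,h$, $\beta\in G_{\Lambda_a}$) in which all nonzero coefficients have the same absolute value.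
   Context: Embed $K\subset\mathbb C$ with $\sqrt{D_K}$ in the upper half plane $\mathcal H$; $D_K<0$ is the discriminant, $h$ the class number. Hecke character $\varphi$ of infinity type $[-1/2;1,0]$ with conductor $\mathfrak c_f$: a homomorphism from fractional ideals prime to $\mathfrak c_f$ to $\mathbb C^\times$ with $\varphi(\alpha\mathcal O_K)=\alpha\chi'_\varphi(\alpha)$ for $\alpha\in\mathcal O_K$ prime to $\mathfrak c_f$, for a character $\chi'_\varphi$ of $(\mathcal O_K/\mathfrak c_f)^\times$, $\mathfrak c_f$ minimal. Hecke theta function: $\vartheta(\tau;\varphi)=\sum_I\varphi(I)e^{2\pi i\tau\mathrm{Nm}(I)}$ over nonzero integral ideals, $\varphi(I)=0$ if $I$ not prime to $\mathfrak c_f$. Let $z_1,\dots,z_h\in\mathcal H$ represent the $\mathbb C$-isomorphism classes of elliptic curves with CM by $\mathcal O_K$, $\mathfrak b_{z_a}=\mathbb Z+z_a\mathbb Z$. For $z=z_a$ let $(a_z,b_z,c_z)$ be coprime integers, $a_z>0$, $a_zz^2+b_zz+c_z=0$. Let $\Lambda_a$ be the lattice with basis $e_2,e_1$ and Gram matrix $f_\rho\begin{pmatrix}2a_z&b_z\\ b_z&2c_z\end{pmatrix}$, $G_{\Lambda_a}=\Lambda_a^\vee/\Lambda_a$, $\Omega'_a$ the $\mathbb Q$-linear map to $\mathbb C$ with $\Omega'_a(e_2)=\sqrt{2a_zf_\rho}$, $\Omega'_a(e_1)=-\sqrt{2a_zf_\rho}z$, and $\Omega_a=i\sqrt{|G_{\Lambda_a}|}(2a_zf_\rho)^{-1/2}\Omega'_a$;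 then $\Omega_a(\Lambda_a^\vee)=\mathfrak b_{z_a}$ and $\Omega_a(\Lambda_a)=\underline{\mathfrak c}\,\mathfrak b_{z_a}$, so $G_{\Lambda_a}\cong\mathfrak b_{z_a}/\underline{\mathfrak c}\mathfrak b_{z_a}$, on which the group $(\mathcal O_K/\underline{\mathfrak c})^\times$ (the CM group) acts by multiplication; write $g\cdot\beta$. Put $f_a(\tau;\beta)=\sum_{y\in\Lambda_a^\vee,\,y+\Lambda_a=\beta}\Omega'_a(y)e^{\pi iN\tau(y,y)}$. For a character $\chi$ of the CM group let $F_a^{\chi^{-1}}$ be the span over $\beta_0\in G_{\Lambda_a}$ of $\sum_{g\in(\mathcal O_K/\underline{\mathfrak c})^\times}\chi(g)f_a(\tau;g^{-1}\cdot\beta_0)$, and $F^{\chi^{-1}}(f_\rho)=\sum_{a=1}^hF_a^{\chi^{-1}}$. *)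

(* Defs.v *)
From HB Require Import structures.
From mathcomp Require Import all_boot all_order all_algebra.
From mathcomp Require Import classical_sets boolp reals topology normedtype sequences exp trigo.
From mathcomp.real_closed Require Import complex.
Set Implicit Arguments. Unset Strict Implicit. Unset Printing Implicit Defensive.
Import Order.TTheory GRing.Theory Num.Theory numFieldNormedType.Exports.
Local Open Scope ring_scope.
Local Open Scope classical_set_scope.

Section Defs.
Variable R : realType.
Local Notation C := (R[i]).

Definition cRe (x : C) : R := complex.Re x.
Definition cIm (x : C) : R := complex.Im x.
Definition toC (x : R) : C := (x%:C)%C.
Definition iC : C := ('i)%C.

Definition ccvg (u : nat -> C) (l : C) : Prop :=
  (fun n => cRe (u n)) @ \oo --> cRe l /\ (fun n => cIm (u n)) @ \oo --> cIm l.
Definition clim (u : nat -> C) : C :=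
  (lim ((fun n => cRe (u n)) @ \oo) +i* lim ((fun n => cIm (u n)) @ \oo))%C.
Definition expC (z : C) : C :=
  toC (expR (cRe z)) * (cos (cIm z) +i* sin (cIm z))%C.
Definition eC (z : C) : C := expC (toC (2 * pi) * iC * z).

Definition sqfree (m : int) : Prop := forall d : nat, (d * d %| `|m|)%N -> d = 1%N.
Definition fund_disc (D : int) : Prop :=
  ((D %% 4)%Z = 1 /\ sqfree D) \/
  (exists m : int, D = 4 * m /\ ((m %% 4)%Z = 2 \/ (m %% 4)%Z = 3) /\ sqfree m).

Definition sqrtD (D : int) : C := (0 +i* Num.sqrt (- (D%:~R : R)))%C.
(* omega = (D + sqrt D)/2 ; O_K = Z + Z omega for a fundamental discriminant D *)
Definition omega (D : int) : C := ((D%:~R : C) + sqrtD D) / 2.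
Definition OK (D : int) : set C :=
  fun x => exists u v : int, x = u%:~R + v%:~R * omega D.
Definition KK (D : int) : set C :=
  fun x => exists u v : rat, x = ratr u + ratr v * omega D.
Definition unitOK (D : int) (u : C) : Prop := OK D u /\ u != 0 /\ OK D u^-1.

Definition is_int_ideal (D : int) (I : set C) : Prop :=
  I `<=` OK D /\ I 0 /\ (forall x y, I x -> I y -> I (x + y)) /\
  (forall a x, OK D a -> I x -> I (a * x)) /\ (exists x, I x /\ x != 0).
Definition prin (D : int) (a : C) : set C := fun x => exists b, OK D b /\ x = a * b.
Definition scale_set (l : C) (I : set C) : set C := fun x => exists y, I y /\ x = l * y.
Definition ideal_mul (I J : set C) : set C :=
  fun x => exists s : seq (C * C),
    (forall p, p \in s -> I p.1 /\ J p.2) /\ x = \sum_(p <- s) p.1 * p.2.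
Definition is_frac_ideal (D : int) (I : set C) : Prop :=
  exists l J, KK D l /\ l != 0 /\ is_int_ideal D J /\ I = scale_set l J.
Definition coprimeI (I J : set C) : Prop := exists x y, I x /\ J y /\ x + y = 1.
Definition frac_prime_to (D : int) (m I : set C) : Prop :=
  is_frac_ideal D I /\
  exists J1 J2, is_int_ideal D J1 /\ is_int_ideal D J2 /\ coprimeI J1 m /\
    coprimeI J2 m /\ ideal_mul I J2 = J1.
Definition elt_coprime (D : int) (m : set C) (a : C) : Prop :=
  OK D a /\ coprimeI (prin D a) m.

(* a character of (O_K/m)^x, viewed as a function on the elements of O_K prime to m
   (its values elsewhere are irrelevant) *)
Definition is_char_mod (D : int) (m : set C) (chi : C -> C) : Prop :=
  (forall a b, elt_coprime D m a -> OK D b -> m (a - b) -> chi a = chi b) /\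
  (forall a b, elt_coprime D m a -> elt_coprime D m b -> chi (a * b) = chi a * chi b) /\
  chi 1 = 1.

(* phi : fractional ideals prime to cf -> C^x, homomorphism, with
   phi(alpha O_K) = alpha chi'(alpha) (infinity type [-1/2;1,0]), cf minimal *)
Definition phi_type (D : int) (cf : set C) (phi : set C -> C) (chi' : C -> C) : Prop :=
  is_char_mod D cf chi' /\
  forall a, elt_coprime D cf a -> a != 0 -> phi (prin D a) = a * chi' a.
Definition is_hecke (D : int) (cf : set C) (phi : set C -> C) (chi' : C -> C) : Prop :=
  is_int_ideal D cf /\
  (forall I J, frac_prime_to D cf I -> frac_prime_to D cf J ->
     phi (ideal_mul I J) = phi I * phi J) /\
  (forall I, frac_prime_to D cf I -> phi I != 0) /\
  phi_type D cf phi chi' /\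
  (forall m, is_int_ideal D m -> cf `<=` m -> m <> cf ->
     ~ exists chi'', is_char_mod D m chi'' /\
        forall a, elt_coprime D cf a -> a != 0 -> phi (prin D a) = a * chi'' a).

(* Every nonzero integral ideal is uniquely Z a + Z (b + c omega) with a, c >= 1,
   0 <= b < a (Hermite normal form), and its norm is a * c. *)
Definition hnf (D : int) (a b c : nat) : set C :=
  fun x => exists u v : int, x = u%:~R * a%:R + v%:~R * (b%:R + c%:R * omega D).
Definition phi_ext (cf : set C) (phi : set C -> C) (I : set C) : C :=
  if pselect (coprimeI I cf) then phi I else 0.
(* sum over the integral ideals of norm n, n < M *)
Definition theta_partial (D : int) (cf : set C) (phi : set C -> C) (tau : C) (M : nat) : C :=
  \sum_(1 <= n < M)
    \sum_(a < n.+1 | (0 < a)%N && (a %| n)%N) \sum_(b < a)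
      (if pselect (is_int_ideal D (hnf D a b (n %/ a))) then
         phi_ext cf phi (hnf D a b (n %/ a)) else 0) * eC (tau * n%:R).

(* a CM point: z together with its primitive quadratic form (A,B,Cc) *)
Definition cmpt : Type := (C * int * int * int)%type.
Definition CMpt (z : C) (a b c : int) : cmpt := (z, a, b, c).
Definition cz (p : cmpt) : C := p.1.1.1.
Definition cA (p : cmpt) : int := p.1.1.2.
Definition cB (p : cmpt) : int := p.1.2.
Definition cC (p : cmpt) : int := p.2.

Definition latt_z (z : C) : set C := fun x => exists m n : int, x = m%:~R + n%:~R * z.
Definition is_lattice (L : set C) : Prop :=
  exists w1 w2 : C, w1 != 0 /\ cIm (w2 / w1) != 0 /\
    L = fun x => exists m n : int, x = m%:~R * w1 + n%:~R * w2.
Definition CM_by_OK (D : int) (L : set C) : Prop :=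
  forall l, (forall x, L x -> L (l * x)) <-> OK D l.
Definition homothetic (L1 L2 : set C) : Prop := exists l : C, l != 0 /\ scale_set l L1 = L2.

Definition isInt (x : R) : Prop := exists k : int, x = k%:~R.

(* Lambda = Z e2 + Z e1, a vector s e2 + t e1 (s,t real) is written (s,t);
   Gram matrix f [[2A, B],[B, 2Cc]] *)
Definition bil (f : nat) (p : cmpt) (y1 y2 : R * R) : R :=
  f%:R * (2 * (cA p)%:~R * y1.1 * y2.1 + (cB p)%:~R * (y1.1 * y2.2 + y1.2 * y2.1)
          + 2 * (cC p)%:~R * y1.2 * y2.2).
Definition in_Lam (y : R * R) : Prop := isInt y.1 /\ isInt y.2.
Definition in_dual (f : nat) (p : cmpt) (y : R * R) : Prop :=
  forall m n : int, isInt (bil f p y (m%:~R, n%:~R)).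
Definition same_coset (y1 y2 : R * R) : Prop := in_Lam (y1.1 - y2.1, y1.2 - y2.2).
(* |G_Lambda| = det of the Gram matrix *)
Definition cardG (f : nat) (p : cmpt) : R :=
  (f%:R) ^+ 2 * (4 * (cA p)%:~R * (cC p)%:~R - (cB p)%:~R ^+ 2).
Definition Omega' (f : nat) (p : cmpt) (y : R * R) : C :=
  toC (Num.sqrt (2 * (cA p)%:~R * f%:R)) * (toC y.1 - toC y.2 * cz p).
Definition kappa (f : nat) (p : cmpt) : C :=
  iC * toC (Num.sqrt (cardG f p)) * toC (Num.sqrt (2 * (cA p)%:~R * f%:R))^-1.
Definition Omega (f : nat) (p : cmpt) (y : R * R) : C := kappa f p * Omega' f p y.
Definition OmegaInv (f : nat) (p : cmpt) (x : C) : R * R :=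
  let w := x / (kappa f p * toC (Num.sqrt (2 * (cA p)%:~R * f%:R))) in
  let t := - cIm w / cIm (cz p) in (cRe w + t * cRe (cz p), t).
(* action of alpha in O_K (prime to c) on G_Lambda = b_z / c b_z, on representatives *)
Definition act (f : nat) (p : cmpt) (a : C) (y : R * R) : R * R :=
  OmegaInv f p (a * Omega f p y).

(* f_a(tau; beta) for beta = y + Lambda, y in Lambda^dual: sum over the lattice *)
Definition fa_partial (f : nat) (N : nat) (p : cmpt) (y : R * R) (tau : C) (M : nat) : C :=
  \sum_(i < (2 * M).+1) \sum_(j < (2 * M).+1)
    let v := (y.1 + (i%:~R - M%:~R), y.2 + (j%:~R - M%:~R)) in
    Omega' f p v * expC (toC pi * iC * N%:R%:C%C * tau * toC (bil f p v v)).
Definition fa (f : nat) (N : nat) (p : cmpt) (y : R * R) (tau : C) : C :=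
  clim (fa_partial f N p y tau).

(* residues mod N of O_K : u + v omega, 0 <= u, v < N ; each class of (O_K/c)^x
   is represented exactly |D| = [c : N O_K] times *)
(* generator sum_g chi(g) f_a(tau; g^-1 beta0) = sum_g chi(g)^-1 f_a(tau; g beta0) *)
Definition gen (D : int) (f : nat) (p : cmpt) (chi : C -> C) (c : set C)
    (y0 : R * R) (tau : C) : C :=
  let N := (f * `|D|)%N in
  (`|D|%:R)^-1 *
  \sum_(u < N) \sum_(v < N)
    let al := u%:R + v%:R * omega D in
    (if pselect (elt_coprime D c al) then (chi al)^-1 * fa f N p (act f p al y0) tau else 0).

End Defs.

(* Main.v *)
Require Import Defs.
From HB Require Import structures.
From mathcomp Require Import all_boot all_order all_algebra.
From mathcomp Require Import classical_sets boolp reals topology normedtype sequences exp trigo.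
From mathcomp.real_closed Require Import complex.
From mathcomp Require Import ring lra zify.
Set Implicit Arguments. Unset Strict Implicit. Unset Printing Implicit Defensive.
Import Order.TTheory GRing.Theory Num.Theory numFieldNormedType.Exports.
Local Open Scope ring_scope.
Local Open Scope classical_set_scope.

(** Write [b_z = Z + Z z] for a CM point [z] with form [(A, B, C)], and [c = gamma O_K] with
    [gamma = f sqrt(D)].  Every nonzero integral ideal is [x b_z^-1] for exactly one of the chosen
    points [z] and for [x] in [b_z], unique up to units, and its norm is [A |x|^2].  So the theta
    series is [1/w] times the sum over [z] and over [x] in [b_z] of
    [phi(x b_z^-1) e(tau A |x|^2) = psi(x) * x e(tau A |x|^2)], with [psi(x) = phi(x b_z^-1) / x].
    The point is that [psi] depends on [x] modulo [gamma b_z] only: if [t = A x conj(y)] lies in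
    [x b_z^-1] with [t = 1 mod cf] and [x' = x mod gamma b_z], then [t' = A x' conj(y)] is [1 mod cf]
    too, and applying [phi] to [t' (x b_z^-1) = t (x' b_z^-1)] gives [psi(x) = psi(x')].  Collecting
    the terms of each coset yields the functions [f_a].  Since some power of an ideal is principal,
    [|phi(I)|^2 = Nm(I)], hence [|psi|^2 = A], and [A] cancels against the normalisation [kappa].
    Finally [psi(g x) = chi(g)^-1 psi(x)], so averaging over the CM group rewrites the sum in terms
    of the generators of [F^(chi^-1)].  The lattice sums converge absolutely, which allows summation
    by discs in place of boxes. *)

(** * Complex numbers *)

(** The two sides are summed in different orders: the theta series over Hermite normal forms by
    norm, each [f_a] over square boxes in its lattice. They meet in the discs [A |x|^2 < M], where
    the points lying over one ideal form a single orbit of the units.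

    That every ideal has the form [x b_z^-1] rests on its ring of multipliers being exactly [O_K]:
    only then is the homothety class of its conjugate on the given list. This is where the
    squarefreeness in [fund_disc] enters.

    The quotient of [x] and [x'] is in general not an integer of [O_K], so [phi] cannot be compared
    through it directly. The multipliers [t], [t'] clear denominators, and [phi] is the identity on
    them as long as they are nonzero; hence the need for [cf] to be proper, which [chi (-1) = -1]
    provides.

    Norms are taken in the form [I conj(I) = n O_K], which is visibly multiplicative; an area
    computation links them to the Hermite parameters. Finiteness of the class group is read off from
    the finiteness of the list [zs]. *)

Section ComplexBasics.
Variable R : realType.
Local Notation C := (R[i]).
Implicit Types x y z : C.

Definition nsq x : R := cRe x ^+ 2 + cIm x ^+ 2.

Lemma cext x y : cRe x = cRe y -> cIm x = cIm y -> x = y.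
Proof. by case: x => a b; case: y => c d /= -> ->. Qed.

Lemma cReD x y : cRe (x + y) = cRe x + cRe y. Proof. by case: x; case: y. Qed.
Lemma cImD x y : cIm (x + y) = cIm x + cIm y. Proof. by case: x; case: y. Qed.
Lemma cReN x : cRe (- x) = - cRe x. Proof. by case: x. Qed.
Lemma cImN x : cIm (- x) = - cIm x. Proof. by case: x. Qed.
Lemma cReM x y : cRe (x * y) = cRe x * cRe y - cIm x * cIm y.
Proof. by case: x; case: y. Qed.
Lemma cImM x y : cIm (x * y) = cRe x * cIm y + cIm x * cRe y.
Proof. by case: x; case: y. Qed.
Lemma cReJ x : cRe (conjc x) = cRe x. Proof. by case: x. Qed.
Lemma cImJ x : cIm (conjc x) = - cIm x. Proof. by case: x. Qed.
Lemma toCD (a b : R) : toC (a + b) = toC a + toC b. Proof. exact: rmorphD. Qed.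
Lemma toCM (a b : R) : toC (a * b) = toC a * toC b. Proof. exact: rmorphM. Qed.
Lemma toCX (a : R) n : toC (a ^+ n) = toC a ^+ n. Proof. exact: rmorphXn. Qed.
Lemma toCV (a : R) : toC a^-1 = (toC a)^-1. Proof. exact: fmorphV. Qed.
Lemma toC_int (k : int) : toC (k%:~R : R) = k%:~R. Proof. exact: rmorph_int. Qed.
Lemma toC_nat (k : nat) : toC (k%:R : R) = k%:R. Proof. exact: rmorph_nat. Qed.
Lemma toC1 : toC (1 : R) = 1. Proof. by []. Qed.
Lemma toC_inj : injective (@toC R). Proof. exact: complexI. Qed.
Lemma cRe_toC (a : R) : cRe (toC a) = a. Proof. by []. Qed.
Lemma cIm_toC (a : R) : cIm (toC a) = 0. Proof. by []. Qed.
Lemma cRe_int (k : int) : cRe (k%:~R : C) = k%:~R. Proof. by rewrite -toC_int. Qed.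
Lemma cIm_int (k : int) : cIm (k%:~R : C) = 0. Proof. by rewrite -toC_int. Qed.
Lemma cRe_nat (k : nat) : cRe (k%:R : C) = k%:R. Proof. by rewrite -toC_nat. Qed.
Lemma cIm_nat (k : nat) : cIm (k%:R : C) = 0. Proof. by rewrite -toC_nat. Qed.
Definition cE := (cReD, cImD, cReN, cImN, cReM, cImM, cReJ, cImJ, cRe_toC, cIm_toC,
  cRe_int, cIm_int, cRe_nat, cIm_nat).

Lemma conj_int (k : int) : conjc (k%:~R : C) = k%:~R. Proof. exact: rmorph_int. Qed.

Lemma conjD x y : conjc (x + y) = conjc x + conjc y. Proof. exact: rmorphD. Qed.
Lemma conjM x y : conjc (x * y) = conjc x * conjc y. Proof. exact: rmorphM. Qed.

Lemma mulcJ x : x * conjc x = toC (nsq x).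
Proof. by apply: cext; rewrite !cE /nsq; ring. Qed.
Lemma nsqM x y : nsq (x * y) = nsq x * nsq y.
Proof. by rewrite /nsq !cE; ring. Qed.
Lemma nsq_ge0 x : 0 <= nsq x. Proof. by rewrite /nsq addr_ge0 ?sqr_ge0. Qed.
Lemma nsq_eq0 x : (nsq x == 0) = (x == 0).
Proof.
rewrite /nsq paddr_eq0 ?sqr_ge0 // !sqrf_eq0; apply/andP/eqP => [[/eqP a /eqP b]|->].
  exact: cext.
by [].
Qed.
Lemma nsq_gt0 x : (0 < nsq x) = (x != 0).
Proof. by rewrite lt_def nsq_ge0 nsq_eq0 andbT. Qed.
Lemma nsq_toC (a : R) : nsq (toC a) = a ^+ 2.
Proof. by rewrite /nsq !cE; ring. Qed.
Lemma nsq1 : nsq 1 = 1.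
Proof. by rewrite -toC1 nsq_toC expr1n. Qed.
Lemma nsqX x n : nsq (x ^+ n) = nsq x ^+ n.
Proof. by elim: n => [|n IH]; rewrite ?expr0 ?nsq1 // !exprS nsqM IH. Qed.
Lemma nsqV x : nsq x^-1 = (nsq x)^-1.
Proof.
have [->|x0] := eqVneq x 0; first by rewrite invr0 /nsq /= expr0n /= addr0 invr0.
have n0 : nsq x != 0 by rewrite nsq_eq0.
by apply: (mulfI n0); rewrite -nsqM !mulfV // nsq1.
Qed.
Lemma norm_nsq x y : nsq x = nsq y -> `|x| = `|y|.
Proof. by move=> h; rewrite !normc_def -/(cRe x) -/(cIm x) -/(nsq x) h. Qed.

Lemma intC_inj (k l : int) : k%:~R = l%:~R :> C -> k = l.
Proof. by move/eqP; rewrite eqr_int => /eqP. Qed.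

Lemma cRe_latt z (u v : int) : cRe (u%:~R + v%:~R * z) = u%:~R + v%:~R * cRe z.
Proof. by rewrite !cE mul0r subr0. Qed.
Lemma cIm_latt z (u v : int) : cIm (u%:~R + v%:~R * z) = v%:~R * cIm z.
Proof. by rewrite !cE mul0r addr0 add0r. Qed.

Lemma latt_inj z (u v u' v' : int) : cIm z != 0 ->
  u%:~R + v%:~R * z = u'%:~R + v'%:~R * z -> u = u' /\ v = v'.
Proof.
move=> z0 h; have := congr1 (@cIm R) h; have := congr1 (@cRe R) h; rewrite !cE => hr hi.
have hv : v = v'.
  apply/eqP; rewrite -(eqr_int R); apply/eqP; apply: (mulIf z0); move: hi; lra.
by subst v'; split=> //; apply/eqP; rewrite -(eqr_int R); apply/eqP; move: hr; lra.
Qed.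

End ComplexBasics.

(** * The order [O_K] *)

Section QuadraticOrder.
Variables (R : realType) (D : int).
Hypotheses (hD : fund_disc D) (hDneg : D < 0).
Local Notation C := (R[i]).
Local Notation w := (omega R D).
Local Notation O := (@OK R D).
Local Notation rD := (Num.sqrt (- (D%:~R : R))).

Lemma rD_gt0 : 0 < rD.
Proof. by rewrite sqrtr_gt0 oppr_gt0 ltrz0. Qed.
Lemma rD_sq : rD ^+ 2 = - D%:~R.
Proof. by rewrite sqr_sqrtr // oppr_ge0 lerz0 ltW. Qed.
Lemma sqrtD_sq : sqrtD R D ^+ 2 = D%:~R.
Proof. by apply: cext; rewrite expr2 !cE /sqrtD /= ?mulr0 ?mul0r ?addr0 //;
  rewrite -expr2 rD_sq; ring. Qed.
Lemma nsq_sqrtD : nsq (sqrtD R D) = - D%:~R.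
Proof. by rewrite /nsq /= expr0n /= add0r rD_sq. Qed.
Lemma sqrtD_neq0 : sqrtD R D != 0.
Proof. by rewrite -nsq_eq0 nsq_sqrtD oppr_eq0 intr_eq0 lt_eqF. Qed.
Lemma sqrtDE : sqrtD R D = 2 * w - D%:~R.
Proof. by rewrite /omega mulrC divfK ?pnatr_eq0 // addrC addKr. Qed.
Lemma cIm_omega : cIm w = rD / 2.
Proof.
have : cIm (sqrtD R D) = cIm (2 * w - D%:~R) by rewrite -sqrtDE.
by rewrite !cE /=; lra.
Qed.
Lemma cRe_omega : cRe w = D%:~R / 2.
Proof.
have : cRe (sqrtD R D) = cRe (2 * w - D%:~R) by rewrite -sqrtDE.
by rewrite !cE /=; lra.
Qed.
Lemma cIm_omega_gt0 : 0 < cIm w.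
Proof. by rewrite cIm_omega divr_gt0 // rD_gt0. Qed.
Lemma cIm_omega_neq0 : cIm w != 0.
Proof. by rewrite gt_eqF // cIm_omega_gt0. Qed.
Lemma disc_ge3 : (3 <= `|D|)%N.
Proof. by case: hD => [[h _]|[m [h [h' _]]]]; lia. Qed.

(** The norm of [omega], that is [w * conjc w]. The division is exact because [D] is 0 or 1 modulo
    4. *)
Definition qD : int := ((D * D - D) %/ 4)%Z.
Lemma qDE : 4 * qD = D * D - D.
Proof.
have [k hk] : exists k, D * D - D = 4 * k; last by rewrite /qD hk mulKz.
case: hD => [[h _]|[m [h _]]].
  exists ((D %/ 4)%Z * D).
  have e : D - 1 = (D %/ 4)%Z * 4 by rewrite {1}(divz_eq D 4) h addrK.
  by transitivity ((D - 1) * D); [ring|rewrite e; ring].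
by exists (4 * m * m - m); rewrite h; ring.
Qed.
Lemma omega_sq : w ^+ 2 = D%:~R * w - qD%:~R.
Proof.
have h4 : (4 : C) != 0 by rewrite pnatr_eq0.
apply: (mulfI h4).
have : (2 * w - D%:~R) ^+ 2 = D%:~R by rewrite -sqrtDE sqrtD_sq.
have : 4 * (qD%:~R : C) = D%:~R * D%:~R - D%:~R.
  by have := congr1 (fun k : int => k%:~R : C) qDE; rewrite !intrM intrB intrM.
move=> e1 e2; rewrite mulrBr e1.
transitivity ((2 * w - D%:~R) ^+ 2 + 4 * (D%:~R * w) - D%:~R * D%:~R); first by ring.
by rewrite e2; ring.
Qed.
Lemma conj_omega : conjc w = D%:~R - w.
Proof. by apply: cext; rewrite ?(cReJ, cImJ) ?(cReD, cImD) ?(cReN, cImN)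
  ?(cRe_int, cIm_int) ?(cRe_omega, cIm_omega); lra. Qed.

Lemma OKint (k : int) : O k%:~R.
Proof. by exists k, 0; rewrite mul0r addr0. Qed.
Lemma OKnat (k : nat) : O k%:R. Proof. exact: (OKint k). Qed.
Lemma OK0 : O 0. Proof. exact: (OKint 0). Qed.
Lemma OK1 : O 1. Proof. exact: (OKint 1). Qed.
Lemma OKomega : O w. Proof. by exists 0, 1; rewrite add0r mul1r. Qed.
Lemma OKD x y : O x -> O y -> O (x + y).
Proof. by move=> [u [v ->]] [u' [v' ->]]; exists (u + u'), (v + v'); rewrite !intrD; ring. Qed.
Lemma OKN x : O x -> O (- x).
Proof. by move=> [u [v ->]]; exists (- u), (- v); rewrite !intrN; ring. Qed.
Lemma OKB x y : O x -> O y -> O (x - y).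
Proof. by move=> hx hy; apply: OKD => //; apply: OKN. Qed.
Lemma OKM x y : O x -> O y -> O (x * y).
Proof.
move=> [u [v ->]] [u' [v' ->]].
exists (u * u' - v * v' * qD), (u * v' + v * u' + v * v' * D).
rewrite !(intrD, intrB, intrM).
transitivity (u%:~R * u'%:~R + (u%:~R * v'%:~R + v%:~R * u'%:~R) * w
   + v%:~R * v'%:~R * w ^+ 2); first by ring.
rewrite omega_sq; ring.
Qed.
Lemma OKX x n : O x -> O (x ^+ n).
Proof. by move=> hx; elim: n => [|n IH]; [exact: OK1|rewrite exprS; exact: OKM]. Qed.
Lemma OKJ x : O x -> O (conjc x).
Proof.
move=> [u [v ->]]; rewrite conjD conjM !conj_int conj_omega.
by exists (u + v * D), (- v); rewrite intrD intrM intrN; ring.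
Qed.
Lemma OK_sqrtD : O (sqrtD R D).
Proof. by rewrite sqrtDE; apply: OKB; [apply: OKM; [exact: (OKnat 2)|exact: OKomega]|exact: OKint]. Qed.
Lemma OK_real x : O x -> cIm x = 0 -> exists k : int, x = k%:~R.
Proof.
move=> [u [v ->]]; rewrite cIm_latt => /eqP.
rewrite mulf_eq0 (negPf cIm_omega_neq0) orbF intr_eq0 => /eqP ->.
by exists u; rewrite mul0r addr0.
Qed.
(** Such an [r] is a positive rational integer dividing 1. This yields both the uniqueness of ideal
    norms and [nsq u = 1] for units. *)
Lemma OK_unit_real (r : R) : 0 < r -> O (toC r) -> O (toC r^-1) -> r = 1.
Proof.
move=> r0 /OK_real - /(_ erefl) [k hk] /OK_real - /(_ erefl) [l hl].
have k0 : 0 < k by rewrite -(ltr0z R) -[X in _ < X]cRe_toC toC_int -hk.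
have l0 : 0 < l by rewrite -(ltr0z R) -[X in _ < X]cRe_toC toC_int -hl cRe_toC invr_gt0.
have kl : k * l = 1.
  by apply: (@intC_inj R); rewrite intrM -hk -hl -toCM mulfV ?gt_eqF.
apply: toC_inj; rewrite hk toC1.
by have -> : k = 1 by nia.
Qed.
Lemma OK_nsq x : O x -> exists k : int, nsq x = k%:~R.
Proof.
move=> hx; have [k hk] := OK_real (OKM hx (OKJ hx)) ltac:(by rewrite mulcJ).
by exists k; apply: toC_inj; rewrite -mulcJ hk toC_int.
Qed.

End QuadraticOrder.

(** * Bezout relations, subgroups of the integers, and primitivity from a fundamental
    discriminant *)

Section IntegerFacts.

Lemma Bezoutz3 (a b c : int) : gcdz (gcdz a b) c = 1 ->
  exists u v t : int, u * a + v * b + t * c = 1.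
Proof.
move=> g1; have [u [v e1]] := Bezoutz a b; have [u' [t e2]] := Bezoutz (gcdz a b) c.
exists (u' * u), (u' * v), t; rewrite -g1 -e2 -e1; ring.
Qed.

Lemma dvdz_gcd3_cancel (a b c t : int) : gcdz (gcdz a b) c = 1 ->
  (a %| t * b)%Z -> (a %| t * c)%Z -> (a %| t)%Z.
Proof.
move=> /Bezoutz3[u [v [s e]]] /dvdzP[q hb] /dvdzP[r hc].
apply/dvdzP; exists (t * u + v * q + s * r).
rewrite -[LHS]mulr1 -e; transitivity (t * u * a + v * (t * b) + s * (t * c)); first by ring.
by rewrite hb hc; ring.
Qed.

Lemma int_subgroup_gen (P : int -> Prop) :
  (forall k l, P k -> P l -> P (k - l)) -> (exists k, P k /\ k != 0) ->
  exists g : nat, (0 < g)%N /\ forall k, P k <-> (g %| k)%Z.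
Proof.
move=> hB [k0 [hk0 k00]].
have P0 : P 0 by rewrite -(subrr k0); apply: hB.
have PN k : P k -> P (- k) by move=> h; rewrite -[- k]add0r; apply: hB.
have PD k l : P k -> P l -> P (k + l).
  by move=> h h'; rewrite -[l]opprK; apply: hB => //; apply: PN.
have PM k m : P k -> P (m * k).
  move=> h; elim: m => [|m IH|m IH]; first by rewrite mul0r.
  - by rewrite -addn1 PoszD mulrDl mul1r; apply: PD.
  - by rewrite -addn1 PoszD opprD mulrDl mulN1r; apply: hB.
pose Q n := (0 < n)%N && `[< P n%:Z >].
have exQ : exists n, Q n.
  exists `|k0|%N; rewrite /Q absz_gt0 k00; apply/asboolP.
  by case: (leP 0 k0) => h; [rewrite gez0_abs|rewrite ltz0_abs //; apply: PN].
case: (ex_minnP exQ) => g /andP[g0 /asboolP Pg] gmin.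
exists g; split=> // k; split=> [hk|/dvdzP[m ->]]; last exact: PM.
have hr : P (k %% g)%Z.
  by have := hB _ _ hk (PM _ (k %/ g)%Z Pg); rewrite {1}(divz_eq k g) addrC addKr.
apply/dvdz_mod0P; have r0 : 0 <= (k %% g)%Z by apply: modz_ge0; lia.
have rg : (k %% g)%Z < g by rewrite ltz_pmod //; lia.
case: (eqVneq (k %% g)%Z 0) => // rn0.
have := gmin `|(k %% g)%Z|%N; rewrite /Q absz_gt0 rn0 /=.
move=> /(_ _); have -> : `[< P (Posz `|(k %% g)%Z|) >] by apply/asboolP; rewrite gez0_abs.
by move=> /(_ isT); lia.
Qed.

(** The square of a common factor [n] divides [D]. Squarefreeness leaves only [n = 1], or [n = 2]
    with [D = 4 m]; in the latter case [m = T'^2 - 4 a' k'] is 0 or 1 modulo 4, whereas [m] is 2 or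
    3. *)
Lemma fund_disc_primitive (D : int) : fund_disc D -> forall a T k : int, T ^+ 2 - 4 * (a * k) = D ->
  gcdz (gcdz a T) k = 1.
Proof.
move=> hD a T k e; set g := gcdz _ _.
have ga : (g %| a)%Z by rewrite (dvdz_trans (dvdz_gcdl _ _)) // dvdz_gcdl.
have gT : (g %| T)%Z by rewrite (dvdz_trans (dvdz_gcdl _ _)) // dvdz_gcdr.
have gk : (g %| k)%Z by rewrite dvdz_gcdr.
have [n gn] : exists n : nat, g = n by exists `|g|%N; rewrite gez0_abs.
move: ga gT gk; rewrite gn => /dvdzP[a' ea] /dvdzP[T' eT] /dvdzP[k' ek].
have eD : D = (T' ^+ 2 - 4 * (a' * k')) * (n%:Z * n%:Z) by rewrite -e ea eT ek; ring.
have nD (m : int) : (exists q : int, m = q * (n%:Z * n%:Z)) -> (n * n %| `|m|)%N.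
  by case=> q ->; rewrite abszM dvdn_mull // abszM.
case: hD => [[_ sq]|[m [em [hm sq]]]].
  by rewrite (sq n) //; apply: nD; exists (T' ^+ 2 - 4 * (a' * k')).
have [on|en] := boolP (odd n).
  rewrite (sq n) //.
  have : (n * n %| 4 * `|m|)%N.
    have -> : (4 * `|m| = `|D|)%N by rewrite em abszM.
    by apply: nD; exists (T' ^+ 2 - 4 * (a' * k')).
  rewrite Gauss_dvdr //; apply: (@coprimeXr 2 (n * n) 2).
  by rewrite coprimeMl coprimen2 on.
have [h nE] : exists h : nat, n = (2 * h)%N by exists n./2; rewrite mul2n -[LHS]odd_double_half (negPf en).
have em' : m = (T' ^+ 2 - 4 * (a' * k')) * (h%:Z * h%:Z).
  by move: eD; rewrite nE em; lia.
have h1 : h = 1%N.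
  by apply: sq; rewrite em' abszM dvdn_mull // abszM.
exfalso; have {}em' : m = T' * T' - 4 * (a' * k') by rewrite em' h1; ring.
have [t tE] : exists t : int, T' = 2 * t \/ T' = 2 * t + 1.
  exists (T' %/ 2)%Z; have := divz_eq T' 2.
  by have : 0 <= (T' %% 2)%Z < 2 by [rewrite modz_ge0 // ltz_pmod]; lia.
by case: tE => tE; move: hm; rewrite em' tE; nia.
Qed.
End IntegerFacts.

(** * Ideals of [O_K] and their Hermite normal forms *)

Section Covolume.
Variable R : realType.
Local Notation C := (R[i]).

(** [cIm (conjc w1 * w2)] is the oriented area of the parallelogram on [w1], [w2], and [k] is the
    determinant of the coordinates of [v1], [v2]. *)
Lemma lattice_subset_covolume (w1 w2 v1 v2 : C) :
  (exists m n : int, v1 = m%:~R * w1 + n%:~R * w2) ->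
  (exists m n : int, v2 = m%:~R * w1 + n%:~R * w2) ->
  exists k : int, cIm (conjc v1 * v2) = k%:~R * cIm (conjc w1 * w2).
Proof.
move=> [m [n ->]] [m' [n' ->]]; exists (m * n' - n * m').
by rewrite !cE !(intrB, intrM); ring.
Qed.

Lemma lattice_covolume (w1 w2 v1 v2 : C) :
  (fun x => exists m n : int, x = m%:~R * w1 + n%:~R * w2) =
  (fun x => exists m n : int, x = m%:~R * v1 + n%:~R * v2) ->
  `|cIm (conjc w1 * w2)| = `|cIm (conjc v1 * v2)|.
Proof.
move=> e.
have l1 (x y : C) : exists m n : int, x = m%:~R * x + n%:~R * y by exists 1, 0; ring.
have l2 (x y : C) : exists m n : int, y = m%:~R * x + n%:~R * y by exists 0, 1; ring.
have [k hk] := @lattice_subset_covolume v1 v2 w1 w2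
  ltac:(by have := l1 w1 w2; rewrite -[X in X -> _]/((fun x => exists m n : int, x = m%:~R * w1 + n%:~R * w2) w1) e)
  ltac:(by have := l2 w1 w2; rewrite -[X in X -> _]/((fun x => exists m n : int, x = m%:~R * w1 + n%:~R * w2) w2) e).
have [l hl] := @lattice_subset_covolume w1 w2 v1 v2
  ltac:(by have := l1 v1 v2; rewrite -[X in X -> _]/((fun x => exists m n : int, x = m%:~R * v1 + n%:~R * v2) v1) -e)
  ltac:(by have := l2 v1 v2; rewrite -[X in X -> _]/((fun x => exists m n : int, x = m%:~R * v1 + n%:~R * v2) v2) -e).
set X := cIm _ in hk hl *; set Y := cIm _ in hk hl *.
have [Y0|Y0] := eqVneq Y 0; first by rewrite hk Y0 mulr0.
have kl : k * l = 1.
  apply/eqP; rewrite -(eqr_int R) intrM; apply/eqP; apply: (mulIf Y0).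
  by rewrite mul1r {2}hl hk; ring.
have /eqP k1 : `|k|%N == 1%N by rewrite -dvdz1; apply/dvdzP; exists l; rewrite mulrC.
have : k = 1 \/ k = -1 by lia.
by case=> kE; rewrite hk kE ?mul1r // intrN mulN1r normrN.
Qed.

End Covolume.

Section IdealProduct.
Variable R : realType.
Local Notation C := (R[i]).
Implicit Types (I J m : set C).

Lemma imul_mem I J x y : I x -> J y -> ideal_mul I J (x * y).
Proof.
move=> hx hy; exists [:: (x, y)]; rewrite big_seq1; split=> // p.
by rewrite inE => /eqP ->.
Qed.
Lemma imul0 I J : ideal_mul I J 0.
Proof. by exists [::]; rewrite big_nil. Qed.
Lemma imulD I J x y : ideal_mul I J x -> ideal_mul I J y -> ideal_mul I J (x + y).
Proof.
move=> [s [hs ->]] [t [ht ->]]; exists (s ++ t); rewrite big_cat; split=> // p.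
by rewrite mem_cat => /orP[/hs|/ht].
Qed.
Lemma imul_ind I J (P : set C) : P 0 -> (forall x y, P x -> P y -> P (x + y)) ->
  (forall x y, I x -> J y -> P (x * y)) -> ideal_mul I J `<=` P.
Proof.
move=> P0 PD PM x [s [hs ->]]; elim: s hs => [|p s IH] hs; first by rewrite big_nil.
rewrite big_cons; apply: PD; first by have [] := hs p (mem_head _ _); exact: PM.
by apply: IH => q qs; apply: hs; rewrite inE qs orbT.
Qed.
End IdealProduct.

Section Ideals.
Variables (R : realType) (D : int).
Hypotheses (hD : fund_disc D) (hDneg : D < 0).
Local Notation C := (R[i]).
Local Notation w := (omega R D).
Local Notation O := (@OK R D).
Local Notation ideal := (@is_int_ideal R D).
Implicit Types (I J m : set C).

Lemma ideal_sub I : ideal I -> I `<=` O. Proof. by case. Qed.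
Lemma ideal0 I : ideal I -> I 0. Proof. by case=> _ []. Qed.
Lemma idealD I x y : ideal I -> I x -> I y -> I (x + y).
Proof. by case=> _ [_ [h _]]; exact: h. Qed.
Lemma idealM I a x : ideal I -> O a -> I x -> I (a * x).
Proof. by case=> _ [_ [_ [h _]]]; exact: h. Qed.
Lemma idealN I x : ideal I -> I x -> I (- x).
Proof. by move=> h hx; rewrite -mulN1r; apply: idealM => //; apply: OKN; exact: OK1. Qed.
Lemma idealB I x y : ideal I -> I x -> I y -> I (x - y).
Proof. by move=> h hx hy; apply: idealD => //; apply: idealN. Qed.

Lemma ideal_OK : ideal O.
Proof.
split=> //; split; first exact: OK0.
split; first exact: OKD.
by split; [move=> a x; exact: OKM|exists 1; split; [exact: OK1|exact: oner_neq0]].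
Qed.

Lemma ideal_scale I a : ideal I -> O a -> a != 0 -> ideal (scale_set a I).
Proof.
move=> hI ha a0; split; first by move=> _ [y [hy ->]]; apply: OKM => //; exact: ideal_sub hy.
split; first by exists 0; rewrite mulr0; split=> //; exact: ideal0.
split; first by move=> _ _ [x [hx ->]] [y [hy ->]]; exists (x + y); split; [exact: idealD|rewrite mulrDr].
split; first by move=> b _ hb [x [hx ->]]; exists (b * x); split; [exact: idealM|rewrite mulrCA].
case: hI => _ [_ [_ [_ [x [hx x0]]]]].
by exists (a * x); split; [exists x|rewrite mulf_neq0].
Qed.

Lemma prinE a : prin D a = scale_set a O. Proof. by []. Qed.

Lemma ideal_prin a : O a -> a != 0 -> ideal (prin D a).
Proof. by rewrite prinE; apply: ideal_scale; exact: ideal_OK. Qed.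

Lemma ideal_imul I J : ideal I -> ideal J -> ideal (ideal_mul I J).
Proof.
move=> hI hJ; split.
  apply: imul_ind; [exact: OK0|exact: OKD|move=> x y hx hy].
  by apply: OKM => //; [exact: ideal_sub hx|exact: ideal_sub hy].
split; first exact: imul0.
split; first exact: imulD.
split.
  move=> a x ha; move: x; apply: (imul_ind (P := fun x => ideal_mul I J (a * x))).
  - by rewrite mulr0; exact: imul0.
  - by move=> x y; rewrite mulrDr; exact: imulD.
  - by move=> x y hx hy; rewrite mulrA; apply: imul_mem => //; exact: idealM.
case: hI => _ [_ [_ [_ [x [hx x0]]]]]; case: hJ => _ [_ [_ [_ [y [hy y0]]]]].
by exists (x * y); split; [exact: imul_mem|rewrite mulf_neq0].
Qed.

Lemma imul_prin I a : ideal I -> ideal_mul (prin D a) I = scale_set a I.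
Proof.
move=> hI; apply/seteqP; split.
- apply: imul_ind.
  + by exists 0; rewrite mulr0; split=> //; exact: ideal0.
  + by move=> _ _ [x [hx ->]] [y [hy ->]]; exists (x + y); split; [exact: idealD|rewrite mulrDr].
  + by move=> _ y [b [hb ->]] hy; exists (b * y); split; [exact: idealM|rewrite mulrA].
- move=> _ [y [hy ->]]; apply: imul_mem => //.
  by exists 1; split; [exact: OK1|rewrite mulr1].
Qed.

Lemma imul_OK I : ideal I -> ideal_mul I O = I.
Proof.
move=> hI; apply/seteqP; split.
- apply: imul_ind; [exact: ideal0|by move=> x y; exact: idealD|].
  by move=> x y hx hy; rewrite mulrC; exact: idealM.
- by move=> x hx; rewrite -[x]mulr1; apply: imul_mem => //; exact: OK1.
Qed.

Lemma scale_set1 I : scale_set 1 I = I.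
Proof.
by apply/seteqP; split=> [_ [y [hy ->]]|x hx]; [rewrite mul1r|exists x; rewrite mul1r].
Qed.

Lemma coprimeS I I' J J' : I `<=` I' -> J `<=` J' -> coprimeI I J -> coprimeI I' J'.
Proof. by move=> h h' [x [y [hx [hy e]]]]; exists x, y; do !split=> //; [exact: h|exact: h']. Qed.

Lemma coprime_imul I J m : ideal I -> ideal J -> ideal m ->
  coprimeI I m -> coprimeI J m -> coprimeI (ideal_mul I J) m.
Proof.
move=> hI hJ hm [x [s [hx [hs e]]]] [y [r [hy [hr e']]]].
exists (x * y), (s + x * r); split; first exact: imul_mem.
split; last by rewrite addrCA -mulrDr e' mulr1 addrC.
by apply: idealD => //; apply: idealM => //; exact: ideal_sub hx.
Qed.

Lemma coprime_OK m : ideal m -> coprimeI O m.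
Proof. by move=> hm; exists 1, 0; split; [exact: OK1|split; [exact: ideal0|rewrite addr0]]. Qed.

Lemma frac_prime_ideal I m : ideal m -> ideal I -> coprimeI I m -> frac_prime_to D m I.
Proof.
move=> hm hI cI; split.
  exists 1, I; split; first by exists 1, 0; rewrite rmorph1 rmorph0 mul0r addr0.
  by split; [exact: oner_neq0|split=> //; rewrite scale_set1].
exists I, O; split=> //; split; first exact: ideal_OK.
split=> //; split; first exact: coprime_OK.
exact: imul_OK.
Qed.

Lemma coprime_one_mod I m : coprimeI I m -> ideal m -> exists t, I t /\ m (t - 1).
Proof.
by move=> [t [s [ht [hs e]]]] hm; exists t; split=> //; rewrite -e opprD addNKr; apply: idealN.
Qed.

Lemma elt_coprime1 m t : ideal m -> O t -> m (t - 1) -> elt_coprime D m t.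
Proof.
move=> hm ht h; split=> //; exists t, (1 - t); split; first by exists 1; rewrite mulr1; split=> //; exact: OK1.
by split; [rewrite -opprB; apply: idealN|rewrite addrC subrK].
Qed.

Lemma elt_coprimeS (m m' : set C) a : m `<=` m' -> elt_coprime D m a -> elt_coprime D m' a.
Proof. by move=> h [ha ca]; split=> //; apply: coprimeS ca. Qed.

Lemma elt_coprimeM m a b : ideal m -> elt_coprime D m a -> elt_coprime D m b -> elt_coprime D m (a * b).
Proof.
move=> hm [ha [_ [s [[x [hx ->]] [hs e]]]]] [hb [_ [r [[y [hy ->]] [hr e']]]]].
split; first exact: OKM.
exists ((a * b) * (x * y)), (s + a * x * r); split; first by exists (x * y); split=> //; exact: OKM.
split; first by apply: idealD => //; apply: idealM => //; exact: OKM.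
transitivity (a * x * (b * y + r) + s); first by ring.
by rewrite e' mulr1.
Qed.

Lemma elt_coprimeX m a n : ideal m -> elt_coprime D m a -> elt_coprime D m (a ^+ n).
Proof.
move=> hm ha; elim: n => [|n IH]; last by rewrite exprS; exact: elt_coprimeM.
by apply: elt_coprime1 => //; [exact: OK1|rewrite subrr; exact: ideal0].
Qed.

Lemma elt_coprime_inv m a : ideal m -> elt_coprime D m a ->
  exists b, elt_coprime D m b /\ m (a * b - 1).
Proof.
move=> hm [ha [_ [s [[x [hx ->]] [hs e]]]]]; exists x; split; last first.
  by rewrite -e opprD addNKr; apply: idealN.
split=> //; exists (x * a), s; split; first by exists a.
by split=> //; rewrite mulrC.
Qed.

Lemma ideal_int I : ideal I -> exists k : int, I k%:~R /\ k != 0.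
Proof.
move=> hI; have := hI; case=> _ [_ [_ [_ [x [hx x0]]]]].
have hxO := ideal_sub hI hx.
have [k hk] := OK_nsq hD hDneg hxO; exists k; split.
  by rewrite -toC_int -hk -mulcJ mulrC; apply: idealM => //; exact: OKJ.
by rewrite -(intr_eq0 R) -hk nsq_eq0.
Qed.

Lemma hnf_mem a b c (u v : int) : @hnf R D a b c (u%:~R + v%:~R * w) <->
  exists s t : int, u = s * a + t * b /\ v = t * c.
Proof.
split=> [[s [t e]]|[s [t [-> ->]]]].
  exists s, t; apply: (latt_inj (cIm_omega_neq0 R hDneg)); rewrite e.
  by rewrite !(intrD, intrM) /=; ring.
by exists s, t; rewrite !(intrD, intrM) /=; ring.
Qed.

(** [a] generates the group of integers in [I] and [c] the group of [omega]-coordinates; both groups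
    are nonzero because [I] contains a nonzero integer. An element with [omega]-coordinate [c] then
    has its first coordinate reduced modulo [a]. *)
Lemma hnf_exists I : ideal I ->
  exists a b c : nat, [/\ (0 < a)%N, (b < a)%N, (0 < c)%N & I = @hnf R D a b c].
Proof.
move=> hI; have [k0 [hk0 k00]] := ideal_int hI.
have [a [a0 ha]] : exists g : nat, (0 < g)%N /\ forall k : int, I k%:~R <-> (g %| k)%Z.
  apply: (int_subgroup_gen (P := fun k : int => I k%:~R)); last by exists k0.
  by move=> k l hk hl; rewrite intrB; exact: idealB.
have [c [c0 hc]] : exists g : nat, (0 < g)%N /\
    forall k : int, (exists u : int, I (u%:~R + k%:~R * w)) <-> (g %| k)%Z.
  apply: (int_subgroup_gen (P := fun k : int => exists u : int, I (u%:~R + k%:~R * w))).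
    move=> k l [u hu] [v hv]; exists (u - v); have := idealB hI hu hv.
    by rewrite !intrB; congr I; ring.
  exists k0; split=> //; exists 0; rewrite add0r mulrC; apply: idealM => //; exact: OKomega.
have [u0 hu0] : exists u : int, I (u%:~R + c%:Z%:~R * w) by apply/hc.
have b0 : 0 <= (u0 %% a)%Z by apply: modz_ge0; lia.
have ba : (u0 %% a)%Z < a by rewrite ltz_pmod //; lia.
have hb : I ((u0 %% a)%Z%:~R + c%:Z%:~R * w).
  have : I ((u0 %/ a)%Z * a)%:~R by apply/ha; rewrite dvdz_mull.
  move/(idealB hI hu0); rewrite {1}(divz_eq u0 a) [in (_ + _)%:~R]intrD; congr I; ring.
have [b hbE] : exists b : nat, (u0 %% a)%Z = b by exists `|(u0 %% a)%Z|%N; rewrite gez0_abs.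
rewrite hbE in b0 ba hb.
exists a, b, c; split=> //; apply/seteqP; split=> x.
- move=> hx; have [u [v xE]] := ideal_sub hI hx; rewrite xE in hx *.
  have /hc/dvdzP[t vE] : exists u : int, I (u%:~R + v%:~R * w) by exists u.
  have : I (u - t * b)%:~R.
    have := idealB hI hx (idealM hI (OKint R D t) hb); congr I.
    by rewrite vE !(intrB, intrM); ring.
  case/ha/dvdzP=> s sE; apply/hnf_mem; exists s, t; split=> //.
  by rewrite -sE subrK.
- move=> [s [t ->]]; apply: idealD => //; apply: idealM => //; try exact: OKint.
  by apply/(ha a); rewrite dvdzz.
Qed.

Lemma hnf_inj a b c a' b' c' : (0 < a)%N -> (b < a)%N -> (0 < c)%N ->
  (0 < a')%N -> (b' < a')%N -> (0 < c')%N ->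
  @hnf R D a b c = @hnf R D a' b' c' -> [/\ a = a', b = b' & c = c'].
Proof.
move=> a0 ba c0 a0' ba' c0' e.
have key a1 b1 c1 a2 b2 c2 : (0 < c1)%N -> (0 < c2)%N -> @hnf R D a1 b1 c1 = @hnf R D a2 b2 c2 ->
    (a2%:Z %| a1%:Z)%Z /\ (c2%:Z %| c1%:Z)%Z /\ (c1 = c2 -> (a2%:Z %| b1%:Z - b2%:Z)%Z).
  move=> c10 c20 E.
  have : @hnf R D a1 b1 c1 (a1%:Z%:~R + 0%:~R * w) by apply/hnf_mem; exists 1, 0; lia.
  rewrite E => /hnf_mem[s [t [e1 e2]]].
  have t0 : t = 0 by nia.
  have : @hnf R D a1 b1 c1 (b1%:Z%:~R + c1%:Z%:~R * w) by apply/hnf_mem; exists 0, 1; lia.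
  rewrite E => /hnf_mem[s' [t' [e3 e4]]].
  split; first by apply/dvdzP; exists s; move: e1; rewrite t0; lia.
  split; first by apply/dvdzP; exists t'.
  move=> cc; have t1 : t' = 1 by nia.
  by apply/dvdzP; exists s'; rewrite e3 t1; lia.
have [h1 [h2 _]] := key _ _ _ _ _ _ c0 c0' e.
have [h3 [h4 h5]] := key _ _ _ _ _ _ c0' c0 (esym e).
have aa : a = a' by apply/eqP; rewrite eqn_dvd; apply/andP; split; [exact: h3|exact: h1].
have cc : c = c' by apply/eqP; rewrite eqn_dvd; apply/andP; split; [exact: h4|exact: h2].
split=> //; have /dvdzP[q hq] := h5 (esym cc).
subst a'; have q0 : q = 0 by nia.
by move: hq; rewrite q0; lia.
Qed.

(** Stability under [omega] forces [c] to divide [a] and [b], so [I = c (Z a' + Z th)] with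
    [th = b' + omega]. The equation of [th] gives a quadratic form [(a', 2 b' + D, k)] of
    discriminant [D], which is primitive, and primitivity leaves no multipliers outside
    [Z + Z th = O_K]. *)
Lemma ideal_multiplier I l : ideal I -> (forall x, I x -> I (l * x)) -> O l.
Proof.
move=> hI hl; have [a [b [c [a0 ba c0 IE]]]] := hnf_exists hI.
have hw := OKomega R D.
have Ia : I (a%:Z%:~R + 0%:~R * w) by rewrite IE; apply/hnf_mem; exists 1, 0; lia.
have Ib : I (b%:Z%:~R + c%:Z%:~R * w) by rewrite IE; apply/hnf_mem; exists 0, 1; lia.
have [a' aE] : exists a' : int, a%:Z = a' * c.
  have : I (0%:~R + a%:Z%:~R * w).
    by have := idealM hI hw Ia; congr I; ring.
  by rewrite IE => /hnf_mem[s [t [_ ->]]]; exists t.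
have [b' [k [bE nE]]] : exists b' k : int, b%:Z = b' * c /\ b' ^+ 2 + D * b' + qD D = a' * k.
  have : I ((- c%:Z * qD D)%:~R + (b%:Z + c%:Z * D)%:~R * w).
    have := idealM hI hw Ib; congr I.
    transitivity (b%:~R * w + c%:~R * w ^+ 2); first by ring.
    by rewrite (omega_sq R hD hDneg) !(intrD, intrM, intrN) /=; ring.
  rewrite IE => /hnf_mem[s [t [e1 e2]]]; exists (t - D), (- s).
  have bE : b%:Z = (t - D) * c by move: e2; lia.
  split=> //.
  have cn0 : c%:Z != 0 by lia.
  apply: (mulfI cn0); move: e1; rewrite aE bE; nia.
have c0C : (c%:~R : C) != 0 by rewrite intr_eq0; lia.
set th : C := b'%:~R + w.
have th2 : th ^+ 2 = (2 * b' + D)%:~R * th - (a' * k)%:~R.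
  transitivity (b'%:~R ^+ 2 + 2 * b'%:~R * w + w ^+ 2); first by rewrite /th; ring.
  rewrite (omega_sq R hD hDneg) -nE /th !(intrD, intrM) ; ring.
have thc s t : I (s%:~R + t%:~R * w) -> exists s' t' : int,
    s%:~R + t%:~R * w = c%:~R * (s'%:~R * a'%:~R + t'%:~R * th).
  rewrite IE => /hnf_mem[s' [t' [-> ->]]]; exists s', t'.
  by rewrite aE bE /th !(intrD, intrM); ring.
have hI' x : I x -> exists s t : int, x = c%:~R * (s%:~R * a'%:~R + t%:~R * th).
  by move=> hx; have [s [t xE]] := ideal_sub hI hx; rewrite xE in hx *; exact: thc.
have [s1 [t1 e1]] := hI' _ (hl _ Ia).
have [s2 [t2 e2]] := hI' _ (hl _ Ib).
have {}e1 : l * a'%:~R = s1%:~R * a'%:~R + t1%:~R * th.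
  by apply: (mulfI c0C); rewrite -e1 aE intrM; ring.
have {}e2 : l * th = s2%:~R * a'%:~R + t2%:~R * th.
  by apply: (mulfI c0C); rewrite -e2 bE intrM /th; ring.
have a'0 : 0 < a' by nia.
have a'C : (a'%:~R : C) != 0 by rewrite intr_eq0 gt_eqF.
(* The number [a' * l * th] is computed once from [l * a'] and once from [l * th]. Comparing
   coordinates on [1], [th] makes [a'] divide both [t1 * (2 * b' + D)] and [t1 * k]. *)
have e3 : (- t1 * (a' * k))%:~R + (s1 * a' + t1 * (2 * b' + D))%:~R * th =
   (s2 * a' * a')%:~R + (t2 * a')%:~R * th.
  transitivity (a'%:~R * (l * th)).
    transitivity (l * a'%:~R * th); last by ring.
    rewrite e1; transitivity (s1%:~R * a'%:~R * th + t1%:~R * th ^+ 2); last by ring.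
    by rewrite th2 !(intrD, intrM, intrN); ring.
  by rewrite e2 !intrM; ring.
have [e4 e5] : - t1 * (a' * k) = s2 * a' * a' /\ s1 * a' + t1 * (2 * b' + D) = t2 * a'.
  apply: (@latt_inj R th) => //.
  by rewrite /th cImD cIm_int add0r cIm_omega_neq0.
have [q qE] : exists q, t1 = q * a'.
  apply/dvdzP; apply: (@dvdz_gcd3_cancel _ (2 * b' + D) k).
  - apply: (fund_disc_primitive hD).
    rewrite -nE; transitivity (D * D - 4 * qD D); first by ring.
    by rewrite (qDE hD); ring.
  - by apply/dvdzP; exists (t2 - s1); lia.
  - by apply/dvdzP; exists (- s2); nia.
have -> : l = s1%:~R + q%:~R * th.
  by apply: (mulIf a'C); rewrite e1 qE intrM; ring.
apply: OKD; first exact: OKint.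
by apply: OKM => //; [exact: OKint|apply: OKD => //; exact: OKint].
Qed.

End Ideals.

(** * CM points *)

Section CMPoint.
Variables (R : realType) (D : int).
Hypotheses (hD : fund_disc D) (hDneg : D < 0).
Local Notation C := (R[i]).
Local Notation w := (omega R D).
Local Notation O := (@OK R D).
Local Notation ideal := (@is_int_ideal R D).

Definition CM_point (p : cmpt R) : Prop :=
  [/\ 0 < cIm (cz p), 0 < cA p, gcdz (gcdz (cA p) (cB p)) (cC p) = 1,
      (cA p)%:~R * cz p ^+ 2 + (cB p)%:~R * cz p + (cC p)%:~R = 0
    & CM_by_OK D (latt_z (cz p))].

(* The ideal [x b_z^-1]: since [A b_z conj(b_z) = O_K], the inverse of [b_z] is [A conj(b_z)]. *)
Definition quot_ideal (p : cmpt R) (x : C) : set C :=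
  fun t => exists y, latt_z (cz p) y /\ t = (cA p)%:~R * x * conjc y.

(* [I conj(I) = n O_K], with the additive closure expressed by quantifying over predicates. *)
Definition has_norm (I : set C) (n : R) : Prop :=
  [/\ 0 < n, forall s t, I s -> I t -> exists a, O a /\ s * conjc t = toC n * a
    & forall P : C -> Prop, (forall x y, P x -> P y -> P (x + y)) ->
        (forall s t, I s -> I t -> P (s * conjc t)) -> P (toC n)].

Implicit Types (z x y : C) (I J : set C).

Lemma latt0 z : latt_z z 0. Proof. by exists 0, 0; ring. Qed.
Lemma latt1 z : latt_z z 1. Proof. by exists 1, 0; ring. Qed.
Lemma lattz z : latt_z z z. Proof. by exists 0, 1; ring. Qed.
Lemma lattD z x y : latt_z z x -> latt_z z y -> latt_z z (x + y).
Proof.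
by move=> [m [n ->]] [m' [n' ->]]; exists (m + m'), (n + n'); rewrite !intrD; ring.
Qed.
Lemma lattN z x : latt_z z x -> latt_z z (- x).
Proof. by move=> [m [n ->]]; exists (- m), (- n); rewrite !intrN; ring. Qed.
Lemma latt_int z (k : int) x : latt_z z x -> latt_z z (k%:~R * x).
Proof. by move=> [m [n ->]]; exists (k * m), (k * n); rewrite !intrM; ring. Qed.

(** The third clause of [has_norm], applied to the predicate of being a multiple of the other norm,
    puts [n / m] in [O_K]; by symmetry its inverse lies there too. *)
Lemma has_norm_inj I n m : has_norm I n -> has_norm I m -> n = m.
Proof.
have key n1 n2 : has_norm I n1 -> has_norm I n2 -> O (toC (n1 / n2)).
  move=> [_ _ hn] [m0 hm _].
  have [a [ha e]] : exists a, O a /\ toC n1 = toC n2 * a.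
    apply: (hn (fun x => exists a, O a /\ x = toC n2 * a)); last exact: hm.
    move=> _ _ [a [ha ->]] [b [hb ->]]; exists (a + b); rewrite mulrDr; split=> //.
    exact: OKD.
  rewrite toCM e mulrAC -toCM mulfV ?gt_eqF // mul1r //.
move=> hn hm; have n0 : 0 < n by case: hn.
have m0 : 0 < m by case: hm.
have := OK_unit_real hDneg (divr_gt0 n0 m0) (key _ _ hn hm).
rewrite invf_div => /(_ (key _ _ hm hn)) e.
have mn0 : m != 0 by rewrite gt_eqF.
by rewrite -[n](divfK mn0) e mul1r.
Qed.

Lemma has_norm_mul I J n m : has_norm I n -> has_norm J m -> has_norm (ideal_mul I J) (n * m).
Proof.
move=> [n0 an bn] [m0 am bm]; split; first exact: mulr_gt0.
- pose Q x := exists a, O a /\ x = toC (n * m) * a.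
  have Q0 : Q 0 by exists 0; rewrite mulr0; split=> //; exact: OK0.
  have QD x y : Q x -> Q y -> Q (x + y).
    move=> [a [ha ->]] [b [hb ->]]; exists (a + b); rewrite mulrDr; split=> //.
    exact: OKD.
  move=> s t hs ht.
  move: s hs; apply: (imul_ind (P := fun s => Q (s * conjc t))) => //.
  + by rewrite mul0r.
  + by move=> x y; rewrite mulrDl; exact: QD.
  move=> s s' hs hs'.
  move: t ht; apply: (imul_ind (P := fun t => Q (s * s' * conjc t))) => //.
  + by rewrite conjc0 mulr0.
  + by move=> x y; rewrite conjD mulrDr; exact: QD.
  move=> t t' ht ht'.
  have [a [ha ea]] := an _ _ hs ht; have [b [hb eb]] := am _ _ hs' ht'.
  exists (a * b); split; first exact: OKM.
  transitivity ((s * conjc t) * (s' * conjc t')); first by rewrite conjM; ring.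
  by rewrite ea eb toCM; ring.
- move=> P PD hP; rewrite toCM; apply: (bn (fun x => P (x * toC m))).
    by move=> x y; rewrite mulrDl; exact: PD.
  move=> s t hs ht; apply: (bm (fun x => P (s * conjc t * x))).
    by move=> x y; rewrite mulrDr; exact: PD.
  move=> s' t' hs' ht'.
  have -> : s * conjc t * (s' * conjc t') = (s * s') * conjc (t * t') by rewrite conjM; ring.
  by apply: hP; exact: imul_mem.
Qed.

Section Point.
Variable p : cmpt R.
Hypothesis hp : CM_point p.
Local Notation z := (cz p).
Local Notation A := (cA p).
Local Notation B := (cB p).
Local Notation Cc := (cC p).
Local Notation b := (latt_z z).

Lemma cIm_cz_neq0 : cIm z != 0. Proof. by case: hp => h *; rewrite gt_eqF. Qed.
Lemma cA_neq0 : (A%:~R : C) != 0. Proof. by case: hp => _ h *; rewrite intr_eq0 gt_eqF. Qed.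
Lemma cA_neq0R : (A%:~R : R) != 0. Proof. by case: hp => _ h *; rewrite intr_eq0 gt_eqF. Qed.
Lemma cA_gt0R : 0 < (A%:~R : R). Proof. by case: hp => _ h *; rewrite ltr0z. Qed.
Lemma cz_sq : A%:~R * z ^+ 2 = - B%:~R * z - Cc%:~R.
Proof.
case: hp => _ _ _ e _; transitivity (0 - B%:~R * z - Cc%:~R); last by ring.
by rewrite -e; ring.
Qed.
Lemma lattO a x : O a -> b x -> b (a * x).
Proof. by case: hp => _ _ _ _ h /h; apply. Qed.

(** Since [omega] stabilises [b_z], it equals [r + s z]. Since [A z] stabilises [b_z] by the
    quadratic equation, it lies in [O_K] and [s] divides [A]. Finally [omega z] in [b_z] and the
    primitivity of the form make [A] divide [s]; as both are positive, [s = A]. *)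
Lemma omega_latt : exists r : int, w = r%:~R + A%:~R * z.
Proof.
case: hp => z0 A0 g1 _ hCM.
have [r [s ws]] : b w by rewrite -[w]mulr1; apply: lattO; [exact: OKomega|exact: latt1].
have sI : s%:~R * cIm z = cIm w by rewrite ws cIm_latt.
have s0 : 0 < s.
  by rewrite -(ltr0z R) -(pmulr_lgt0 _ z0) sI cIm_omega_gt0.
have [u [v hv]] : O (A%:~R * z).
  apply/hCM => _ [m [n ->]]; exists (- n * Cc), (m * A - n * B).
  transitivity (m%:~R * A%:~R * z + n%:~R * (A%:~R * z ^+ 2)); first by ring.
  by rewrite cz_sq !(intrM, intrB, intrN); ring.
have Avs : A = v * s.
  apply/eqP; rewrite -(eqr_int R); apply/eqP; apply: (mulIf cIm_cz_neq0).
  have := congr1 (@cIm R) hv; rewrite cIm_latt -sI.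
  by have := cIm_latt z 0 A; rewrite add0r => -> ->; rewrite intrM mulrA.
have [m [n hw]] : b (w * z) by apply: lattO; [exact: OKomega|exact: lattz].
have e : (- s * Cc)%:~R + (r * A - s * B)%:~R * z = (m * A)%:~R + (n * A)%:~R * z.
  transitivity (A%:~R * (w * z)).
    rewrite ws; transitivity (r%:~R * A%:~R * z + s%:~R * (A%:~R * z ^+ 2)); last by ring.
    by rewrite cz_sq !(intrM, intrB, intrN); ring.
  by rewrite hw !intrM; ring.
have [e1 e2] := latt_inj cIm_cz_neq0 e.
have As : (A %| s)%Z.
  apply: (dvdz_gcd3_cancel g1); apply/dvdzP; first by exists (r - n); lia.
  by exists (- m); lia.
have sA : s = A.
  case/dvdzP: As => q qE.
  have q0 : 0 < q by rewrite -(pmulr_lgt0 _ A0) -qE.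
  have v0 : 0 < v by rewrite -(pmulr_lgt0 _ s0) -Avs.
  by apply/eqP; rewrite eq_le {1}Avs qE !ler_peMl //; lia.
by exists r; rewrite -sA.
Qed.

Lemma cIm_cz : A%:~R * cIm z = cIm w.
Proof. by have [r ->] := omega_latt; rewrite cIm_latt. Qed.
Lemma cRe_cz : 2 * (A%:~R * cRe z) = - B%:~R.
Proof.
have := congr1 (@cIm R) cz_sq; rewrite expr2 !cE => h; apply: (mulIf cIm_cz_neq0); move: h; lra.
Qed.
Lemma conj_cz : A%:~R * conjc z = - B%:~R - A%:~R * z.
Proof. by have h := cRe_cz; apply: cext; rewrite !cE; lra. Qed.
Lemma cz_conj : A%:~R * (z * conjc z) = Cc%:~R.
Proof. by rewrite mulrCA conj_cz mulrBr mulrCA -expr2 cz_sq; ring. Qed.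
Lemma nsq_cz : A%:~R * nsq z = Cc%:~R.
Proof. by apply: toC_inj; rewrite toCM -mulcJ !toC_int cz_conj. Qed.
Lemma sqrtD_cz : sqrtD R D = 2 * A%:~R * z + B%:~R.
Proof.
have [r e] := omega_latt.
have h1 : cRe w = D%:~R / 2 := cRe_omega R D.
have h2 := cRe_cz; rewrite e cRe_latt in h1.
rewrite sqrtDE {1}e; apply: (@etrans _ _ (2 * A%:~R * z + (2 * r - D)%:~R)).
  by rewrite intrB intrM; ring.
congr (_ + _); rewrite -!toC_int; congr toC; rewrite intrB intrM; lra.
Qed.
Lemma disc_form : B ^+ 2 - 4 * (A * Cc) = D.
Proof.
apply: (@intC_inj R); rewrite -(sqrtD_sq R hDneg) sqrtD_cz.
transitivity (B%:~R ^+ 2 - 4 * (A%:~R * Cc%:~R) : C).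
  by rewrite intrB !intrM expr2.
transitivity (4 * A%:~R * (A%:~R * z ^+ 2) + 4 * A%:~R * B%:~R * z + B%:~R ^+ 2); last by ring.
by rewrite cz_sq; ring.
Qed.

Lemma pairing_OK x y : b x -> b y -> O (A%:~R * x * conjc y).
Proof.
have [r e] := omega_latt.
have hz : A%:~R * z = w - r%:~R by rewrite e addrC addKr.
have h1 : O (A%:~R * z) by rewrite hz; apply: OKB; [exact: OKomega|exact: OKint].
have h2 : O (A%:~R * conjc z) by rewrite conj_cz; apply: OKB => //; rewrite -intrN; exact: OKint.
move=> [m [n ->]] [m' [n' ->]]; rewrite conjD conjM !conj_int.
have -> : A%:~R * (m%:~R + n%:~R * z) * (m'%:~R + n'%:~R * conjc z) =
  (A * m * m')%:~R + (n * m')%:~R * (A%:~R * z) + (m * n')%:~R * (A%:~R * conjc z)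
  + (n * n')%:~R * (A%:~R * (z * conjc z)) by rewrite !intrM; ring.
rewrite cz_conj.
have hi k : O k%:~R := OKint R D k.
have hm := OKM hD hDneg.
apply: OKD; last exact: hm.
apply: OKD; last exact: hm.
by apply: OKD; last exact: hm.
Qed.

(** The pairings of [1] and [z] include [A] and [A z conj(z) = C], and two of them add up to
    [A z + A conj(z) = - B]; a Bezout relation for the primitive form then produces 1. Together with
    [pairing_OK] this is [A b_z conj(b_z) = O_K]. *)
Lemma pairing_one (P : C -> Prop) : (forall x y, P x -> P y -> P (x + y)) ->
  (forall x y, b x -> b y -> P (A%:~R * x * conjc y)) -> P 1.
Proof.
move=> PD hP; case: hp => _ _ g1 _ _; have [u [v [t e]]] := Bezoutz3 g1.
have -> : 1 = A%:~R * u%:~R * conjc 1 + A%:~R * (- v%:~R * z) * conjc 1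
   + A%:~R * (- v%:~R) * conjc z + A%:~R * (t%:~R * z) * conjc z :> C.
  transitivity (u%:~R * A%:~R + v%:~R * (- (A%:~R * z) - (A%:~R * conjc z)) +
     t%:~R * (A%:~R * (z * conjc z))); last by rewrite conjc1; ring.
  rewrite conj_cz cz_conj -[LHS]/(1%:~R) -e !(intrD, intrM); ring.
have hi (k : int) : b k%:~R by rewrite -[_%:~R]mulr1; apply: latt_int; exact: latt1.
have hz (k : int) : b (k%:~R * z) by apply: latt_int; exact: lattz.
have h1 := latt1 z; have hz1 := lattz z; rewrite -intrN.
apply: (PD); last exact: hP.
apply: (PD); last exact: hP.
by apply: (PD); exact: hP.
Qed.

Lemma quot_ideal_ideal x : b x -> x != 0 -> ideal (quot_ideal p x).
Proof.
move=> hx x0; split; first by move=> _ [y [hy ->]]; exact: pairing_OK.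
split; first by exists 0; rewrite conjc0 mulr0; split=> //; exact: latt0.
split.
  move=> _ _ [y [hy ->]] [y' [hy' ->]]; exists (y + y'); rewrite conjD mulrDr.
  by split=> //; exact: lattD.
split.
  move=> a _ ha [y [hy ->]]; exists (conjc a * y); rewrite conjM conjcK mulrCA.
  by split=> //; apply: lattO => //; exact: OKJ.
exists (A%:~R * x); split; last by rewrite mulf_neq0 // cA_neq0.
by exists 1; rewrite conjc1 mulr1; split=> //; exact: latt1.
Qed.

(** As 1 is a sum of terms [A s conj(t)], the number [x] is a sum of terms [(A x conj(t)) s] whose
    first factor lies in [O_K]. *)
Lemma quot_ideal_sub x : quot_ideal p x `<=` O -> b x.
Proof.
move=> h; rewrite -[x]mulr1; apply: (pairing_one (P := fun t => b (x * t))).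
  by move=> s t; rewrite mulrDr; exact: lattD.
move=> s t hs ht; have -> : x * (A%:~R * s * conjc t) = (A%:~R * x * conjc t) * s by ring.
by apply: lattO => //; apply: h; exists t.
Qed.

Lemma quot_ideal_norm x : x != 0 -> has_norm (quot_ideal p x) (A%:~R * nsq x).
Proof.
move=> x0; split; first by rewrite mulr_gt0 ?cA_gt0R ?nsq_gt0.
- move=> _ _ [y [hy ->]] [y' [hy' ->]]; exists (A%:~R * y' * conjc y).
  split; first exact: pairing_OK.
  by rewrite toCM toC_int -mulcJ !conjM conj_int conjcK; ring.
- move=> P PD hP; rewrite -[toC _]mulr1.
  apply: (pairing_one (P := fun t => P (toC (A%:~R * nsq x) * t))).
    by move=> s t; rewrite [_ * (s + t)]mulrDr; exact: PD.
  move=> s t hs ht.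
  have -> : toC (A%:~R * nsq x) * (A%:~R * s * conjc t) =
    (A%:~R * x * conjc t) * conjc (A%:~R * x * conjc s).
    by rewrite toCM toC_int -mulcJ !conjM conj_int conjcK; ring.
  by apply: hP; [exists t|exists s].
Qed.

Lemma quot_ideal_scale a x : scale_set a (quot_ideal p x) = quot_ideal p (a * x).
Proof.
apply/seteqP; split=> [_ [_ [[y [hy ->]] ->]]|_ [y [hy ->]]].
  by exists y; split=> //; ring.
by exists (A%:~R * x * conjc y); split; [exists y|ring].
Qed.

(** Two bases of one lattice span the same area: [a c Im(omega)] from the Hermite form,
    [A^2 |x|^2 Im(z)] from the basis [A x], [A x conj(z)]. Now use [A Im(z) = Im(omega)]. *)
Lemma quot_ideal_hnf (a b0 c : nat) x : quot_ideal p x = @hnf R D a b0 c ->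
  (a * c)%:R = A%:~R * nsq x.
Proof.
move=> e.
have : (fun t : C => exists m n : int, t = m%:~R * a%:R + n%:~R * (b0%:R + c%:R * w)) =
   (fun t : C => exists m n : int, t = m%:~R * (A%:~R * x) + n%:~R * (A%:~R * x * conjc z)).
  rewrite -[LHS]/(@hnf R D a b0 c) -e; apply/seteqP; split.
    move=> _ [_ [[m [n ->]] ->]]; exists m, n.
    by rewrite conjD conjM !conj_int; ring.
  move=> _ [m [n ->]]; exists (m%:~R + n%:~R * z); split; first by exists m, n.
  by rewrite conjD conjM !conj_int; ring.
move/lattice_covolume.
have -> : conjc (A%:~R * x) * (A%:~R * x * conjc z) = toC (A%:~R ^+ 2 * nsq x) * conjc z.
  by rewrite toCM toCX toC_int -mulcJ conjM conj_int; ring.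
rewrite conjc_nat.
have -> : cIm (a%:R * (b0%:R + c%:R * w)) = a%:R * c%:R * cIm w.
  by rewrite cImM cImD [cIm (c%:R * _)]cImM !(cRe_nat, cIm_nat); ring.
rewrite cImM cRe_toC cIm_toC cImJ mul0r addr0 mulrN normrN -cIm_cz.
rewrite expr2 !normrM !normr_nat (gtr0_norm cA_gt0R) (ger0_norm (nsq_ge0 x)) => h.
have z0 : `|cIm z| != 0 by rewrite normr_eq0 cIm_cz_neq0.
apply: (mulIf z0); apply: (mulIf cA_neq0R); rewrite natrM.
transitivity (a%:R * c%:R * (A%:~R * `|cIm z|)); first by ring.
by rewrite h; ring.
Qed.

Lemma quot_ideal_unit x x' : x != 0 -> x' != 0 -> quot_ideal p x = quot_ideal p x' ->
  unitOK D (x' / x).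
Proof.
have key x1 x2 : x1 != 0 -> x2 != 0 -> quot_ideal p x1 = quot_ideal p x2 -> O (x1 / x2).
  (* The lattice variable of [quot_ideal] is conjugated, so it is the conjugate of the ratio that
     maps [b_z] into itself. *)
  move=> x10 x20 e; rewrite -[_ / _]conjcK; apply: OKJ; case: hp => _ _ _ _ h; apply/h.
  move=> y hy; have : quot_ideal p x1 (A%:~R * x1 * conjc y) by exists y.
  rewrite e => -[y' [hy' e']].
  have -> : conjc (x1 / x2) * y = y' => //.
  apply: (can_inj (@conjcK R)); apply: (mulfI (mulf_neq0 cA_neq0 x20)).
  by rewrite -e' [conjc (_ * y)]conjM conjcK; field.
move=> x0 x0' e; split; first by apply: key.
split; first by rewrite mulf_neq0 // invr_eq0.
by rewrite invf_div; apply: key.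
Qed.

Lemma quot_ideal_mul_unit x u : unitOK D u -> quot_ideal p (u * x) = quot_ideal p x.
Proof.
have key x' v : O v -> quot_ideal p (v * x') `<=` quot_ideal p x'.
  move=> hv _ [y [hy ->]]; exists (conjc v * y); split.
    by apply: lattO => //; exact: OKJ.
  by rewrite conjM conjcK; ring.
move=> [hu [u0 hu']]; apply/seteqP; split; first exact: key.
by rewrite -{1}[x](mulKf u0); exact: key.
Qed.

End Point.

Lemma quot_ideal_homothetic p q x y : CM_point p -> CM_point q -> x != 0 -> y != 0 ->
  quot_ideal p x = quot_ideal q y -> homothetic (latt_z (cz p)) (latt_z (cz q)).
Proof.
move=> hp hq x0 y0 e; have p0 := cA_neq0 hp; have q0 := cA_neq0 hq.
have px := mulf_neq0 p0 x0; have qy := mulf_neq0 q0 y0.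
exists (conjc (((cA p)%:~R * x) / ((cA q)%:~R * y))); split.
  by rewrite conjc_eq0 mulf_neq0 // invr_eq0.
apply/seteqP; split.
  move=> _ [t [ht ->]]; have : quot_ideal p x ((cA p)%:~R * x * conjc t) by exists t.
  rewrite e => -[t' [ht' e']].
  have -> // : conjc ((cA p)%:~R * x / ((cA q)%:~R * y)) * t = t'.
  apply: (can_inj (@conjcK R)); apply: (mulfI qy); rewrite -e' [conjc (_ * t)]conjM conjcK; field.
  by rewrite y0 q0.
move=> t ht; have : quot_ideal q y ((cA q)%:~R * y * conjc t) by exists t.
rewrite -e => -[t' [ht' e']]; exists t'; split=> //.
apply: (can_inj (@conjcK R)); apply: (mulfI qy); rewrite e' [conjc (_ * t')]conjM conjcK; field.
by rewrite y0 q0.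
Qed.

(** The conjugate lattice [L] of [I] has CM by exactly [O_K], by [ideal_multiplier], so it is
    homothetic to some [b_z] on the list; conjugating back gives [I = x b_z^-1]. *)
Lemma quot_ideal_complete (zs : seq (cmpt R)) : (forall p, p \in zs -> CM_point p) ->
  (forall L : set C, is_lattice L -> CM_by_OK D L ->
     exists2 p, p \in zs & homothetic L (latt_z (cz p))) ->
  forall I, ideal I -> exists p x, [/\ p \in zs, latt_z (cz p) x, x != 0 & I = quot_ideal p x].
Proof.
move=> hzs hcomp I hI; have [a [b [c [a0 ba c0 IE]]]] := hnf_exists hD hDneg hI.
pose L : set C := fun x => exists m n : int, x = m%:~R * a%:R + n%:~R * (b%:R + c%:R * conjc w).
have cE (m n : int) (t : C) : conjc (m%:~R * a%:R + n%:~R * (b%:R + c%:R * t) : C) =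
    m%:~R * a%:R + n%:~R * (b%:R + c%:R * conjc t).
  by rewrite !(conjD, conjM) !conj_int !conjc_nat.
have LE x : L x <-> I (conjc x).
  rewrite IE; split=> [[m [n ->]]|[m [n e]]]; exists m, n; first by rewrite cE conjcK.
  by rewrite -[x]conjcK e cE.
have a0C : (a%:R : C) != 0 by rewrite pnatr_eq0 -lt0n.
have latL : is_lattice L.
  exists a%:R, (b%:R + c%:R * conjc w); split=> //; split=> //.
  have -> : (b%:R + c%:R * conjc w) / a%:R = toC (b%:R / a%:R) + toC (c%:R / a%:R) * conjc w.
    by rewrite !toCM toCV !toC_nat; ring.
  rewrite cImD cIm_toC add0r cImM cRe_toC cIm_toC mul0r addr0 cImJ mulrN oppr_eq0.
  by rewrite !mulf_neq0 ?invr_eq0 ?pnatr_eq0 -?lt0n // cIm_omega_neq0.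
have cmL : CM_by_OK D L.
  move=> l; split=> [hl|hl x /LE hx]; last first.
    by apply/LE; rewrite conjM; apply: (idealM hI) hx; exact: OKJ.
  rewrite -[l]conjcK; apply: OKJ; apply: (ideal_multiplier hD hDneg hI) => x hx.
  by rewrite -[x]conjcK -conjM; apply/LE; apply: hl; apply/LE; rewrite conjcK.
have [p pz [l [l0 hl]]] := hcomp L latL cmL.
have hp := hzs p pz; have A0 := cA_neq0 hp.
have lc : conjc l != 0 by rewrite conjc_eq0.
(* The solution of [A * x * conjc (l * s) = conjc s], where [l] carries [L] onto [b_z]. *)
pose x := ((cA p)%:~R * conjc l)^-1.
have x0 : x != 0 by rewrite invr_eq0 mulf_neq0.
have EI : I = quot_ideal p x.
  apply/seteqP; split=> [t ht|_ [y [hy ->]]].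
    exists (l * conjc t); split.
      by rewrite -hl; exists (conjc t); split=> //; apply/LE; rewrite conjcK.
    by rewrite conjM conjcK /x; field; rewrite lc A0.
  move: hy; rewrite -hl => -[s [/LE hs ->]].
  suff -> : (cA p)%:~R * x * conjc (l * s) = conjc s by [].
  by rewrite conjM /x; field; rewrite lc A0.
exists p, x; split=> //; apply: (quot_ideal_sub hp); rewrite -EI; exact: ideal_sub.
Qed.

End CMPoint.

(** * The Hecke character on the ideals [x b_z^-1] *)

Lemma pigeonhole (T : finType) (F : nat -> T) : exists i j, (i < j)%N /\ F i = F j.
Proof.
apply: contrapT => h.
have : injective (fun i : 'I_(#|T|.+1) => F i).
  move=> i j e; apply: val_inj; apply/eqP; apply: contrapT => /negP.
  by rewrite neq_ltn => /orP[] ij; apply: h; [exists i, j|exists j, i].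
by move/leq_card; rewrite card_ord ltnn.
Qed.

Section Hecke.
Variables (R : realType) (D : int).
Hypotheses (hD : fund_disc D) (hDneg : D < 0).
Local Notation C := (R[i]).
Local Notation w := (omega R D).
Local Notation O := (@OK R D).
Local Notation ideal := (@is_int_ideal R D).
Variable (f : nat).
Hypothesis (hf : (0 < f)%N).
Local Notation gam := (f%:R * sqrtD R D : C).
Variable zs : seq (cmpt R).
Hypothesis hzs : forall p, p \in zs -> CM_point D p.
Hypothesis hcomplete : forall L : set C, is_lattice L -> CM_by_OK D L ->
     exists2 p, p \in zs & homothetic L (latt_z (cz p)).
Variables (chi : C -> C) (cf : set C) (phi : set C -> C) (chi' : C -> C).
Hypothesis hchiu : forall u, unitOK D u -> chi u = u.
Hypothesis hcf : prin D gam `<=` cf.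
Hypothesis hphi : is_hecke D cf phi chi'.
Hypothesis hpull : forall a, elt_coprime D (prin D gam) a -> chi' a = (chi a)^-1.

(** The value 0 off the ideals prime to [cf] mirrors [phi_ext]; thus invariance modulo [gam b_z]
    includes the invariance of coprimality itself. *)
Definition psi (p : cmpt R) (x : C) : C :=
  if pselect (coprimeI (quot_ideal p x) cf) then phi (quot_ideal p x) / x else 0.

Lemma gam_neq0 : gam != 0.
Proof. by rewrite mulf_neq0 ?sqrtD_neq0 // pnatr_eq0 -lt0n. Qed.
Lemma gam_OK : O gam.
Proof. by apply: OKM => //; [exact: OKnat|exact: OK_sqrtD]. Qed.
Lemma ideal_gam : ideal (prin D gam).
Proof. by apply: ideal_prin => //; [exact: gam_OK|exact: gam_neq0]. Qed.

Let hc : ideal cf. Proof. by case: hphi. Qed.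
Let hchar : is_char_mod D cf chi'. Proof. by case: hphi => _ [_ [_ [[]]]]. Qed.
Let phiM I J : ideal I -> ideal J -> coprimeI I cf -> coprimeI J cf ->
  phi (ideal_mul I J) = phi I * phi J.
Proof.
by move=> hI hJ cI cJ; case: hphi => _ [h _]; apply: h; exact: frac_prime_ideal.
Qed.
Let phi_neq0 I : ideal I -> coprimeI I cf -> phi I != 0.
Proof. by move=> hI cI; case: hphi => _ [_ [h _]]; apply: h; exact: frac_prime_ideal. Qed.
Let phi_prin a : elt_coprime D cf a -> a != 0 -> phi (prin D a) = a * chi' a.
Proof. by case: hphi => _ [_ [_ [[_ h] _]]]; exact: h. Qed.

(* If [1] were in [cf], then [chi' (-1) = chi' 1 = 1], whereas [chi' (-1) = (chi (-1))^-1 = -1]. *)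
Lemma conductor_proper : ~ cf 1.
Proof.
move=> c1; case: hchar => h1 [_ h3].
have eN : elt_coprime D (prin D gam) (- 1).
  split; first by apply: OKN; exact: OK1.
  exists 1, 0; split; first by exists (- 1); split; [apply: OKN; exact: OK1|ring].
  by split; [apply: ideal0; exact: ideal_gam|ring].
have cO x : O x -> cf x by move=> hx; rewrite -[x]mulr1; apply: (idealM hc).
have e : chi' (- 1) = chi' 1.
  apply: h1; [exact: elt_coprimeS eN|exact: OK1|].
  by apply: cO; apply: OKB; [apply: OKN|]; exact: OK1.
have u1 : unitOK D (- 1 : C).
  split; first by apply: OKN; exact: OK1.
  by rewrite oppr_eq0 oner_neq0 invrN1; split=> //; apply: OKN; exact: OK1.
move: e; rewrite h3 hpull // hchiu // invrN1 => /eqP.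
by rewrite eq_sym -addr_eq0 -[1 + 1]/(2%:R) pnatr_eq0.
Qed.

Lemma cf1_neq0 t : cf (t - 1) -> t != 0.
Proof.
move=> h; apply: contra_notN conductor_proper => /eqP t0.
by rewrite t0 sub0r in h; rewrite -[1]opprK; apply: (idealN hc).
Qed.

Lemma elt_coprime_neq0 a : elt_coprime D cf a -> a != 0.
Proof.
move=> [_ [_ [s [[y [_ ->]] [hs e]]]]]; apply: contra_notN conductor_proper => /eqP a0.
by rewrite -e a0 mul0r add0r.
Qed.

Lemma chi'_cf1 t : O t -> cf (t - 1) -> chi' t = 1.
Proof.
move=> ht h; case: hchar => h1 [_ <-]; apply: h1 => //; last exact: OK1.
exact: elt_coprime1.
Qed.

Lemma chi'X a n : elt_coprime D cf a -> chi' (a ^+ n) = chi' a ^+ n.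
Proof.
move=> ha; case: hchar => _ [hM h1]; elim: n => [|n IH]; first by rewrite !expr0.
by rewrite !exprS hM ?IH //; exact: elt_coprimeX.
Qed.

Lemma chi'_neq0 a : elt_coprime D cf a -> chi' a != 0.
Proof.
move=> ha; have a0 := elt_coprime_neq0 ha.
have : phi (prin D a) != 0 by case: ha => hO hcop; apply: phi_neq0 => //; exact: ideal_prin.
by rewrite phi_prin // mulf_eq0 negb_or => /andP[].
Qed.

(** The powers of [a] meet finitely many residues modulo an integer [k] of [cf], so two of them
    share their [chi']-value and [chi' a] is a root of unity. *)
Lemma nsq_chi' a : elt_coprime D cf a -> nsq (chi' a) = 1.
Proof.
move=> ha; have [k [hk k0]] := ideal_int hD hDneg hc.
have hO n : exists uv : int * int, a ^+ n = uv.1%:~R + uv.2%:~R * w.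
  have [u [v e]] : O (a ^+ n) by apply: OKX => //; case: ha.
  by exists (u, v).
have [g gE] := choice hO.
(* The form [.-1.+1] exhibits [|k|] as a successor, as [inord] demands; it equals [|k|] because [k]
   is nonzero. *)
pose res (u : int) : 'I_(`|k|.-1.+1) := inord `|(u %% k)%Z|%N.
have resE u v : res u = res v -> exists q : int, u - v = q * k.
  move/(congr1 val); rewrite /= !inordK; last first.
  - by have := ltz_mod u k0; have := modz_ge0 u k0; lia.
  - by have := ltz_mod v k0; have := modz_ge0 v k0; lia.
  move=> e; have {}e : (u %% k)%Z = (v %% k)%Z.
    by have := modz_ge0 u k0; have := modz_ge0 v k0; lia.
  by exists ((u %/ k)%Z - (v %/ k)%Z); rewrite {1}(divz_eq u k) {1}(divz_eq v k) e; ring.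
have [i [j [ij [e1 e2]]]] := pigeonhole (fun n => (res (g n).1, res (g n).2)).
have [q1 h1] := resE _ _ e1; have [q2 h2] := resE _ _ e2.
have e : chi' (a ^+ i) = chi' (a ^+ j).
  case: hchar => h _; apply: h; [exact: elt_coprimeX|by apply: OKX => //; case: ha|].
  have -> : a ^+ i - a ^+ j = (q1%:~R + q2%:~R * w) * k%:~R.
    transitivity (((g i).1 - (g j).1)%:~R + ((g i).2 - (g j).2)%:~R * w).
      by rewrite !gE !intrB; ring.
    by rewrite h1 h2 !intrM; ring.
  by apply: (idealM hc) => //; exists q1, q2.
move: e; rewrite !chi'X // -(subnKC (ltnW ij)) exprD -[LHS]mulr1.
move/(mulfI (expf_neq0 _ (chi'_neq0 ha)))/(congr1 (@nsq R)); rewrite nsq1 nsqX => /esym/eqP.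
by rewrite pexpr_eq1 ?nsq_ge0 ?subn_gt0 // => /eqP.
Qed.

Lemma quot_ideal_neq0 p x : p \in zs -> coprimeI (quot_ideal p x) cf -> x != 0.
Proof.
move=> pz [_ [s [[y [_ ->]] [hs e]]]]; apply: contra_notN conductor_proper => /eqP x0.
by rewrite -e x0 mulr0 mul0r add0r.
Qed.

Let hquot p x : p \in zs -> latt_z (cz p) x -> coprimeI (quot_ideal p x) cf ->
  ideal (quot_ideal p x).
Proof. by move=> pz hx cx; apply: quot_ideal_ideal => //; [exact: hzs|exact: quot_ideal_neq0 cx]. Qed.

Lemma psi_congr p x x' y : p \in zs -> latt_z (cz p) x -> latt_z (cz p) y ->
  x' = x + gam * y -> psi p x = psi p x'.
Proof.
move=> pz hx hy xx'; have hp := hzs pz.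
have hg : O gam := gam_OK.
have hx' : latt_z (cz p) x' by rewrite xx'; apply: lattD => //; apply: (lattO hp).
have step x1 x2 y' : latt_z (cz p) x1 -> latt_z (cz p) x2 -> latt_z (cz p) y' ->
    x2 = x1 + gam * y' -> coprimeI (quot_ideal p x1) cf ->
    exists t t', [/\ quot_ideal p x1 t, quot_ideal p x2 t', cf (t - 1), cf (t' - 1)
      & t' * x1 = t * x2].
  move=> h1 h2 hy' e cx1; have [t [[v [hv tE]] ht]] := coprime_one_mod cx1 hc.
  exists t, ((cA p)%:~R * x2 * conjc v); split=> //; [by exists v|by exists v| |by rewrite tE; ring].
  have -> : (cA p)%:~R * x2 * conjc v - 1 = gam * ((cA p)%:~R * y' * conjc v) + (t - 1).
    by rewrite tE e; ring.
  apply: (idealD hc) => //; apply: hcf; exists ((cA p)%:~R * y' * conjc v); split=> //.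
  exact: (pairing_OK hD hDneg hp).
(* The congruence is symmetric, so coprimality passes in both directions, the reverse one with
   [- y]; the two values of [psi] are then both zero or both given by [phi]. *)
have cop x1 x2 y' : latt_z (cz p) x1 -> latt_z (cz p) x2 -> latt_z (cz p) y' ->
    x2 = x1 + gam * y' -> coprimeI (quot_ideal p x1) cf -> coprimeI (quot_ideal p x2) cf.
  move=> h1 h2 hy' e /(step _ _ _ h1 h2 hy' e)[t [t' [_ ht' _ h _]]].
  by exists t', (1 - t'); rewrite subrKC; split=> //; split=> //; rewrite -opprB; apply: (idealN hc).
rewrite /psi; case: pselect => c1; case: pselect => c2 //; last first.
- by case: c1; apply: (cop x' x (- y)) => //; [exact: lattN|rewrite xx'; ring].
- by case: c2; apply: (cop x x' y).
have [t [t' [ht ht' ct ct' e]]] := step _ _ _ hx hx' hy xx' c1.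
have x0 := quot_ideal_neq0 pz c1; have x0' := quot_ideal_neq0 pz c2.
have I1 := hquot pz hx c1; have I2 := hquot pz hx' c2.
have tO := ideal_sub I1 ht; have tO' := ideal_sub I2 ht'.
have t0 := cf1_neq0 ct; have t0' := cf1_neq0 ct'.
have et := elt_coprime1 hc tO ct; have et' := elt_coprime1 hc tO' ct'.
have E : t' * phi (quot_ideal p x) = t * phi (quot_ideal p x').
  have pt : phi (prin D t) = t by rewrite phi_prin // chi'_cf1 // mulr1.
  have pt' : phi (prin D t') = t' by rewrite phi_prin // chi'_cf1 // mulr1.
  rewrite -{1}pt' -{1}pt -!phiM //; try by [exact: ideal_prin|case: et|case: et'].
  by rewrite !imul_prin // !quot_ideal_scale e.
apply/eqP; rewrite eqr_div //; apply/eqP; apply: (mulfI t0').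
by rewrite mulrA E mulrAC -e; ring.
Qed.

(** [phi] gains the factor [g * chi' g] from the principal ideal of [g], and the denominator [g * x]
    of [psi] removes the [g]. *)
Lemma psi_act p x g : p \in zs -> latt_z (cz p) x -> elt_coprime D (prin D gam) g ->
  psi p (g * x) = (chi g)^-1 * psi p x.
Proof.
move=> pz hx eg; have hp := hzs pz.
have eg' := elt_coprimeS hcf eg; have g0 := elt_coprime_neq0 eg'.
have gO : O g by case: eg.
have gx : latt_z (cz p) (g * x) by exact: (lattO hp).
rewrite -hpull // /psi; case: pselect => c1; case: pselect => c2; last first.
- by rewrite mulr0.
- have I2 := hquot pz hx c2.
  case: c1; rewrite -quot_ideal_scale -(imul_prin _ I2).
  apply: (coprime_imul (ideal_prin hD hDneg gO g0) I2 hc) => //.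
  by case: eg'.
- case: c2; apply: coprimeS c1 => // _ [y [hy ->]]; exists (conjc g * y); split.
    by apply: (lattO hp) => //; exact: OKJ.
  by rewrite conjM conjcK; ring.
have I2 := hquot pz hx c2; have x0 := quot_ideal_neq0 pz c2.
rewrite /= -quot_ideal_scale -(imul_prin _ I2) phiM //; try by [exact: ideal_prin|case: eg'].
by rewrite phi_prin //; field; rewrite x0 g0.
Qed.

(** The index is off by one: [pw I n] is the power of exponent [n + 1], hence the exponents [n.+1]
    below. *)
Let pw (I : set C) n := iter n (ideal_mul I) I.

(* Two powers [J^i], [J^j] of the ideal lie in the same class, [J^j = (xj / xi) J^i], so that
   [|phi J|^(j - i) = |xj / xi|], while [Nm(J)^(j - i) = |xj / xi|^2]. *)
Lemma nsq_phi p x : p \in zs -> latt_z (cz p) x -> coprimeI (quot_ideal p x) cf ->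
  nsq (phi (quot_ideal p x)) = (cA p)%:~R * nsq x.
Proof.
move=> pz hx cx; have hp := hzs pz; have x0 := quot_ideal_neq0 pz cx.
have I1 := hquot pz hx cx.
set J := quot_ideal p x in cx I1 *; set N := _ * nsq x.
have hN : has_norm D J N by exact: quot_ideal_norm.
have N0 : 0 < N by case: hN.
have pwI n : ideal (pw J n) by elim: n => //= n IH; exact: ideal_imul.
have pwC n : coprimeI (pw J n) cf by elim: n => //= n IH; exact: (coprime_imul I1 (pwI n) hc).
have pwP n : phi (pw J n) = phi J ^+ n.+1.
  by elim: n => [|n IH]; rewrite ?expr1 //= phiM // IH -exprS.
have pwN n : has_norm D (pw J n) (N ^+ n.+1).
  by elim: n => [|n IH]; rewrite ?expr1 //= exprS; exact: has_norm_mul.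
have hq n : exists qx : cmpt R * C, [/\ qx.1 \in zs, latt_z (cz qx.1) qx.2, qx.2 != 0
    & pw J n = quot_ideal qx.1 qx.2].
  have [q [y [? ? ? ?]]] := quot_ideal_complete hD hDneg hzs hcomplete (pwI n).
  by exists (q, y).
have [g gP] := choice hq.
have idx n : (index (g n).1 zs < size zs)%N by rewrite index_mem; case: (gP n).
have [i [j [ij e]]] := pigeonhole (fun n => Ordinal (idx n)).
have [qi bi xi0 Ei] := gP i; have [qj bj xj0 Ej] := gP j.
have {}e : (g i).1 = (g j).1.
  move/(congr1 val): e => /= e.
  by rewrite -(nth_index p qi) e nth_index.
rewrite -e in qj bj Ej; set q := (g i).1 in qi qj bi bj Ei Ej.
set xi := (g i).2 in bi xi0 Ei; set xj := (g j).2 in bj xj0 Ej.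
have hq' := hzs qi.
have Ni : N ^+ i.+1 = (cA q)%:~R * nsq xi.
  by apply: (has_norm_inj hDneg (pwN i)); rewrite Ei; exact: quot_ideal_norm.
have Nj : N ^+ j.+1 = (cA q)%:~R * nsq xj.
  by apply: (has_norm_inj hDneg (pwN j)); rewrite Ej; exact: quot_ideal_norm.
(* The ratio [xj / xi] is cleared of denominators as [t' / t]. While [t] is 1 modulo [cf], its
   partner [t'] is only prime to [cf], so [chi' t'] may differ from 1 and [nsq_chi'] is what
   disposes of it. *)
have [t [ht ct]] := coprime_one_mod (pwC i) hc.
have tO := ideal_sub (pwI i) ht; have t0 := cf1_neq0 ct.
have et := elt_coprime1 hc tO ct.
have [y [hy tE]] : quot_ideal q xi t by rewrite -Ei.
have [t' tE'] : exists t' : C, t' = (cA q)%:~R * xj * conjc y by eexists.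
have ht' : pw J j t' by rewrite Ej; exists y.
have tO' := ideal_sub (pwI j) ht'.
have txt : t' * xi = t * xj by rewrite tE' tE; ring.
have t0' : t' != 0.
  have : t' * xi != 0 by rewrite txt mulf_neq0.
  by rewrite mulf_eq0 negb_or => /andP[].
have sc : ideal_mul (prin D t') (pw J i) = ideal_mul (prin D t) (pw J j).
  by rewrite !imul_prin // Ei Ej !quot_ideal_scale txt.
have It : ideal (prin D t) by exact: ideal_prin.
have It' : ideal (prin D t') by exact: ideal_prin.
have et' : elt_coprime D cf t'.
  split=> //; have : coprimeI (ideal_mul (prin D t') (pw J i)) cf.
    by rewrite sc; apply: (coprime_imul It (pwI j) hc) => //; case: et.
  apply: coprimeS => // s; rewrite imul_prin // => -[y' [hy' ->]].
  by exists y'; split=> //; exact: ideal_sub hy'.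
have := congr1 (fun I => nsq (phi I)) sc; rewrite /= !phiM //; try by [case: et|case: et'].
rewrite !phi_prin // !pwP !nsqM !nsqX !nsq_chi' // !mulr1.
set F := nsq (phi J) => E.
have F0 : 0 < F by rewrite nsq_gt0; exact: phi_neq0.
have E2 : nsq t' * nsq xi = nsq t * nsq xj by rewrite -!nsqM txt.
have nt : nsq t != 0 by rewrite nsq_eq0.
have nx : nsq xi != 0 by rewrite nsq_eq0.
have E3 : nsq xj * F ^+ i.+1 = nsq xi * F ^+ j.+1.
  by apply: (mulfI nt); rewrite mulrA -E2 mulrAC E; ring.
have E4 : N ^+ j.+1 * F ^+ i.+1 = N ^+ i.+1 * F ^+ j.+1.
  by rewrite Ni Nj -!mulrA E3.
have jE : j.+1 = (i.+1 + (j - i))%N by rewrite addSn subnKC // ltnW.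
have E5 : N ^+ (j - i) = F ^+ (j - i).
  have n1 : N ^+ i.+1 * F ^+ i.+1 != 0 by rewrite mulf_neq0 // expf_neq0 // gt_eqF.
  apply: (mulfI n1); move: E4; rewrite jE !exprD => E4.
  transitivity (N ^+ i.+1 * N ^+ (j - i) * F ^+ i.+1); first by ring.
  by rewrite E4; ring.
apply/esym/eqP; rewrite -(@eqrXn2 _ (j - i)) ?subn_gt0 ?ltW //; exact/eqP.
Qed.

Lemma nsq_psi p x : p \in zs -> latt_z (cz p) x -> psi p x != 0 -> nsq (psi p x) = (cA p)%:~R.
Proof.
move=> pz hx; rewrite /psi; case: pselect => cx; last by rewrite eqxx.
move=> _; rewrite nsqM nsqV nsq_phi // mulfK // nsq_eq0.
exact: quot_ideal_neq0 cx.
Qed.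

Lemma phi_ext_psi p x : p \in zs -> phi_ext cf phi (quot_ideal p x) = psi p x * x.
Proof.
move=> pz; rewrite /phi_ext /psi; case: pselect => cx; last by rewrite mul0r.
by rewrite divfK //; exact: quot_ideal_neq0 cx.
Qed.

End Hecke.

(** * Absolutely convergent lattice sums *)

Section BoxSums.
Variable R : realType.

Definition ibox (M : nat) : seq (int * int) :=
  [seq (i%:Z - M%:Z, j%:Z - M%:Z) | i <- iota 0 (2 * M).+1, j <- iota 0 (2 * M).+1].

Lemma mem_ibox M k : (k \in ibox M) = (`|k.1| <= M%:Z) && (`|k.2| <= M%:Z).
Proof.
apply/allpairsP/andP => [[[i j] [hi hj ->]]|[h1 h2]].
  by move: hi hj; rewrite !mem_iota /=; lia.
exists (absz (k.1 + M%:Z), absz (k.2 + M%:Z)); rewrite !mem_iota; case: k h1 h2 => a b /= h1 h2.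
by split; [lia|lia|congr pair; lia].
Qed.

Lemma uniq_ibox M : uniq (ibox M).
Proof.
apply: allpairs_uniq; rewrite ?iota_uniq // => -[i j] [i' j'] _ _ /= [e1 e2].
by congr pair; lia.
Qed.

Lemma ibox_sub M M' : (M <= M')%N -> {subset ibox M <= ibox M'}.
Proof. by move=> MM k; rewrite !mem_ibox; lia. Qed.

Lemma seq_in_ibox (s : seq (int * int)) : exists M, {subset s <= ibox M}.
Proof.
elim: s => [|k s [M IH]]; first by exists 0%N.
exists (M + absz k.1 + absz k.2)%N => l; rewrite inE => /orP[/eqP ->|/IH].
  by case: k => a b; rewrite mem_ibox /=; lia.
by apply: ibox_sub; rewrite -addnA leq_addr.
Qed.

Lemma sum_ibox (T : nmodType) (G : int * int -> T) M :
  \sum_(k <- ibox M) G k =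
  \sum_(i < (2 * M).+1) \sum_(j < (2 * M).+1) G (i%:Z - M%:Z, j%:Z - M%:Z).
Proof.
rewrite /ibox big_allpairs_dep -(big_mkord xpredT (fun i => \sum_(j < (2 * M).+1) G (i%:Z - M%:Z, j%:Z - M%:Z))).
rewrite /index_iota subn0; apply: eq_bigr => i _.
by rewrite -(big_mkord xpredT (fun j => G (i%:Z - M%:Z, j%:Z - M%:Z))) /index_iota subn0.
Qed.

(** Covers both orders of summation at once: the boxes that define [fa] and the discs that come from
    ordering ideals by norm. *)
Definition exhausting (S : nat -> seq (int * int)) : Prop :=
  (forall M, uniq (S M)) /\
  forall k, exists M0, forall M, (M0 <= M)%N -> {subset ibox k <= S M}.

Lemma exhausting_ibox : exhausting ibox.
Proof. by split=> [M|k]; [exact: uniq_ibox|exists k => M; exact: ibox_sub]. Qed.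

Lemma sum_subset_le (T : eqType) (g : T -> R) (s t : seq T) : (forall k, 0 <= g k) ->
  uniq s -> uniq t -> {subset s <= t} -> \sum_(k <- s) g k <= \sum_(k <- t) g k.
Proof.
move=> g0 us ut st; rewrite [leRHS](bigID (mem s)) /=.
have -> : \sum_(k <- s) g k = \sum_(k <- t | k \in s) g k.
  rewrite -[RHS]big_filter; apply: perm_big; apply: uniq_perm; rewrite ?filter_uniq // => k.
  by rewrite mem_filter; case: (boolP (k \in s)) => // /st.
by rewrite lerDl sumr_ge0.
Qed.

Lemma exhausting_cvg_ge0 (g : int * int -> R) K : (forall k, 0 <= g k) ->
  (forall M, \sum_(k <- ibox M) g k <= K) ->
  exists l : R, forall S, exhausting S -> (fun M => \sum_(k <- S M) g k) @ \oo --> l.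
Proof.
move=> g0 gK; pose u M := \sum_(k <- ibox M) g k.
have nd : nondecreasing_seq u.
  by move=> m n mn; apply: sum_subset_le => //; [exact: uniq_ibox|exact: uniq_ibox|exact: ibox_sub].
have cu : cvgn u.
  by apply: nondecreasing_is_cvgn => //; exists K => _ [n _ <-]; exact: gK.
exists (limn u) => S [uS exS]; apply/cvgrPdist_le => e e0.
have /cvgrPdist_le/(_ e e0)[k0 _ hk0] : u @ \oo --> limn u by [].
have [M0 hM0] := exS k0; exists M0 => //= M /= MM.
have ub : \sum_(k <- S M) g k <= limn u.
  have [B hB] := seq_in_ibox (S M).
  apply: (le_trans (sum_subset_le g0 (uS M) (uniq_ibox B) hB)).
  exact: (nondecreasing_cvgn_le nd cu B).
have lb : u k0 <= \sum_(k <- S M) g k.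
  by apply: sum_subset_le => //; [exact: uniq_ibox|exact: hM0].
have := hk0 k0 (leqnn _); rewrite !ger0_norm ?subr_ge0 //.
  by move=> h; apply: le_trans h; rewrite lerD2l lerN2.
exact: (nondecreasing_cvgn_le nd cu k0).
Qed.

(** [g] is the difference of the nonnegative families [|g| + g] and [|g|], each of which has a limit
    common to all exhausting sequences. *)
Lemma exhausting_cvg_abs (g h : int * int -> R) K : (forall k, `|g k| <= h k) ->
  (forall M, \sum_(k <- ibox M) h k <= K) ->
  exists l : R, forall S, exhausting S -> (fun M => \sum_(k <- S M) g k) @ \oo --> l.
Proof.
move=> gh hK.
have hg k : g k <= `|g k| by exact: ler_norm.
have hg' k : - `|g k| <= g k by have := lerNnormlW (lexx `|g k|).
have [l1 h1] : exists l : R, forall S, exhausting S ->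
    (fun M => \sum_(k <- S M) (`|g k| + g k)) @ \oo --> l.
  apply: (@exhausting_cvg_ge0 _ (K + K)) => [k|M]; first by have := hg' k; lra.
  rewrite big_split /=; apply: lerD; apply: le_trans (hK M); apply: ler_sum => k _ //.
  by apply: le_trans (gh k).
have [l2 h2] : exists l : R, forall S, exhausting S ->
    (fun M => \sum_(k <- S M) `|g k|) @ \oo --> l.
  apply: (@exhausting_cvg_ge0 _ K) => [k //|M].
  by apply: le_trans (hK M); apply: ler_sum.
exists (l1 - l2) => S hS.
have -> : (fun M => \sum_(k <- S M) g k) =
    (fun M => \sum_(k <- S M) (`|g k| + g k) - \sum_(k <- S M) `|g k|).
  by apply: funext => M; rewrite big_split /= addrAC subrr add0r.
by apply: cvgB; [exact: h1|exact: h2].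
Qed.

(** The right-hand side is shaped for induction: with [n = M + 1], the two new terms [1 / (1 + n^2)]
    add at most [4 / (n (n + 1)) = 4 / n - 4 / (n + 1)], and the case [M = 0] is an equality. *)
Lemma sum_inv_sq_le M : \sum_(i < (2 * M).+1) (1 + ((i%:Z - M%:Z)%:~R : R) ^+ 2)^-1 <= 5 - 4 / M.+1%:R.
Proof.
elim: M => [|M IH].
  by rewrite muln0 big_ord_recl big_ord0 /= subrr expr0n /= addr0 invr1 addr0; lra.
have -> : ((2 * M.+1).+1 = (2 * M).+3)%N by lia.
rewrite big_ord_recl big_ord_recr /=.
have -> : ((bump 0 (2 * M).+1)%:Z - M.+1%:Z)%:~R = (M.+1%:R : R).
  by have -> : (bump 0 (2 * M).+1)%:Z - M.+1%:Z = M.+1 :> int by rewrite /bump; lia.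
have -> : (0%N%:Z - M.+1%:Z)%:~R = - (M.+1%:R : R) by rewrite sub0r intrN.
rewrite sqrrN.
under eq_bigr => i _ do
  have -> : (bump 0 i)%:Z - M.+1%:Z = i%:Z - M%:Z :> int by rewrite /bump; lia.
set s := \sum_(i < _) _ in IH *; set n : R := M.+1%:R in IH *.
have n1 : 1 <= n by rewrite /n ler1n.
have -> : M.+2%:R = n + 1 by rewrite /n -natr1.
have key : (1 + n ^+ 2)^-1 <= 2 / (n * (n + 1)).
  rewrite ler_pdivlMr; last by apply: mulr_gt0; lra.
  rewrite mulrC ler_pdivrMr; last by have := sqr_ge0 n; lra.
  by rewrite expr2; have := sqr_ge0 (n - 1); rewrite expr2; nra.
have e : 2 / (n * (n + 1)) = 2 / n - 2 / (n + 1) by field; apply/andP; split; apply/eqP; lra.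
move: key IH; rewrite e.
by move: (_^-1) (n^-1) ((n + 1)^-1) s => x y t u; lra.
Qed.

Lemma sum_ibox_inv_sq_le M :
  \sum_(k <- ibox M) ((1 + (k.1%:~R : R) ^+ 2) * (1 + (k.2%:~R : R) ^+ 2))^-1 <= 25.
Proof.
rewrite sum_ibox /=.
under eq_bigr => i _ do (under eq_bigr => j _ do rewrite invfM; rewrite -mulr_sumr).
rewrite -mulr_suml.
have := sum_inv_sq_le M; set s := \sum_(i < _) _ => h.
have h0 : 0 <= s by apply: sumr_ge0 => i _; rewrite invr_ge0 addr_ge0 ?sqr_ge0.
have h4 : 0 <= 4 / (M.+1%:R : R) by rewrite divr_ge0.
have h5 : s <= 5 by apply: (le_trans h); rewrite gerBl.
by apply: (le_trans (ler_pM h0 h0 h5 h5)); lra.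
Qed.

End BoxSums.

(** * Limits of complex sequences *)

Section ComplexLimits.
Variable R : realType.
Local Notation C := (R[i]).
Implicit Types (u v : nat -> C) (l m : C).

Lemma cRe_sum (T : Type) (s : seq T) (F : T -> C) : cRe (\sum_(k <- s) F k) = \sum_(k <- s) cRe (F k).
Proof. by apply: (big_morph (@cRe R) (@cReD R)). Qed.
Lemma cIm_sum (T : Type) (s : seq T) (F : T -> C) : cIm (\sum_(k <- s) F k) = \sum_(k <- s) cIm (F k).
Proof. by apply: (big_morph (@cIm R) (@cImD R)). Qed.

Lemma ccvg0 : ccvg (fun=> 0 : C) 0.
Proof. by split; exact: cvg_cst. Qed.
Lemma ccvgD u v l m : ccvg u l -> ccvg v m -> ccvg (fun n => u n + v n) (l + m).
Proof.
move=> [h1 h2] [h3 h4]; split; rewrite ?cReD ?cImD.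
  by under eq_fun => n do rewrite cReD; exact: cvgD.
by under eq_fun => n do rewrite cImD; exact: cvgD.
Qed.
Lemma ccvgZ c u l : ccvg u l -> ccvg (fun n => c * u n) (c * l).
Proof.
move=> [h1 h2]; split; rewrite ?cReM ?cImM.
  by under eq_fun => n do rewrite cReM; apply: cvgB; apply: cvgMr.
by under eq_fun => n do rewrite cImM; apply: cvgD; apply: cvgMr.
Qed.
Lemma ccvg_sum (T : eqType) (s : seq T) (F : T -> nat -> C) (L : T -> C) :
  (forall k, k \in s -> ccvg (F k) (L k)) ->
  ccvg (fun n => \sum_(k <- s) F k n) (\sum_(k <- s) L k).
Proof.
elim: s => [|k s IH] h.
  by rewrite big_nil; under eq_fun => n do rewrite big_nil; exact: ccvg0.
rewrite big_cons; under eq_fun => n do rewrite big_cons.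
apply: ccvgD; first by apply: h; rewrite mem_head.
by apply: IH => j js; apply: h; rewrite inE js orbT.
Qed.
Lemma ccvg_unique u l m : ccvg u l -> ccvg u m -> l = m.
Proof.
by move=> [h1 h2] [h3 h4]; apply: cext;
  [exact: (cvg_unique (@Rhausdorff R) h1 h3)|exact: (cvg_unique (@Rhausdorff R) h2 h4)].
Qed.
Lemma ccvg_clim u l : ccvg u l -> clim u = l.
Proof. by move=> [h1 h2]; apply: cext; exact: (cvg_lim (@Rhausdorff R)). Qed.

Lemma nsq_expC (z : C) : nsq (expC z) = expR (cRe z) ^+ 2.
Proof.
rewrite /expC nsqM nsq_toC; have -> : nsq (cos (cIm z) +i* sin (cIm z))%C = 1 by exact: cos2Dsin2.
by rewrite mulr1.
Qed.

Lemma abs_Re_Im_le (x : C) (r : R) : 0 <= r -> nsq x <= r ^+ 2 -> `|cRe x| <= r /\ `|cIm x| <= r.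
Proof.
move=> r0 h; split; rewrite -[r](ger0_norm r0) -ler_sqr ?nnegrE // !real_normK ?num_real //.
  by apply: le_trans h; rewrite lerDl sqr_ge0.
by apply: le_trans h; rewrite lerDr sqr_ge0.
Qed.
End ComplexLimits.

(** * Convergence of the theta sum over a shifted lattice *)

Section LatticeTheta.
Variable R : realType.
Local Notation C := (R[i]).

Definition theta_term (a : R) (tau x : C) : C := x * eC (tau * toC (a * nsq x)).
(** For [g = gam] this is the map [Omega]; the minus sign is that of [Omega'], which sends [e_1] to
    a negative multiple of [z]. *)
Definition latt_point (g z : C) (v : R * R) : C := g * (toC v.1 - toC v.2 * z).
Definition shift (y : R * R) (k : int * int) : R * R := (y.1 + k.1%:~R, y.2 + k.2%:~R).

(** One factor [1 + q] bounds the modulus of the point, and the other two pay for the weights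
    [1 + k_1^2] and [1 + k_2^2]. Sharing the exponential among the three factors reduces the bound
    to [1 + d q <= exp(d q)] with [d = c / 3]. *)
Lemma cube_exp_bound (c : R) : 0 < c -> exists2 K : R, 0 <= K &
  forall q, 0 <= q -> (1 + q) ^+ 3 * expR (- (c * q)) <= K.
Proof.
move=> c0; pose d := c / 3.
have d0 : 0 < d by rewrite divr_gt0.
have V0 : 0 < d^-1 by rewrite invr_gt0.
exists ((1 + d^-1) ^+ 3); first by rewrite exprn_ge0 // addr_ge0 // ltW.
move=> q q0; have -> : expR (- (c * q)) = expR (- (d * q)) ^+ 3.
  by rewrite !exprS expr0 mulr1 -!expRD; congr expR; rewrite /d; field.
have n1 : 0 <= (1 + q) * expR (- (d * q)) by rewrite mulr_ge0 ?expR_ge0 // addr_ge0.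
have n2 : 0 <= 1 + d^-1 by rewrite addr_ge0 // ltW.
rewrite -exprMn ler_pXn2r ?nnegrE //.
rewrite expRN ler_pdivrMr ?expR_gt0 //.
have h := expR_ge1Dx (d * q).
apply: (@le_trans _ _ ((1 + d^-1) * (1 + d * q))); last by rewrite ler_pM2l // ltr_wpDr // ltW.
have -> : (1 + d^-1) * (1 + d * q) = 1 + q + (d * q + d^-1).
  by field; rewrite gt_eqF.
rewrite lerDl; apply: addr_ge0; last exact: ltW.
by apply: mulr_ge0 => //; exact: ltW.
Qed.

Lemma nsq_latt_bound (z : C) : cIm z != 0 -> exists2 K : R, 0 <= K &
  forall s t : R, s ^+ 2 + t ^+ 2 <= K * nsq (toC s - toC t * z).
Proof.
move=> z0; pose b := (cIm z ^+ 2)^-1; have i0 : 0 < cIm z ^+ 2 by rewrite exprn_even_gt0.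
have b0 : 0 < b by rewrite invr_gt0.
have c0 : 0 <= (2 * cRe z ^+ 2 + 1) * b.
  by apply: mulr_ge0; [have := sqr_ge0 (cRe z); lra|exact: ltW].
(* With [X = s - t Re(z)], the left side is at most [2 X^2 + (2 Re(z)^2 + 1) t^2], and [nsq] is
   [X^2 + t^2 Im(z)^2]; this dictates the constant. *)
exists (2 + (2 * cRe z ^+ 2 + 1) * b); first exact: addr_ge0.
move=> s t; have -> : nsq (toC s - toC t * z) = (s - t * cRe z) ^+ 2 + t ^+ 2 * cIm z ^+ 2.
  by rewrite /nsq !cE; ring.
set X := s - t * cRe z; have -> : s = X + t * cRe z by rewrite /X; ring.
have -> : (2 + (2 * cRe z ^+ 2 + 1) * b) * (X ^+ 2 + t ^+ 2 * cIm z ^+ 2) =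
  2 * X ^+ 2 + 2 * (t * cRe z) ^+ 2 + t ^+ 2 +
  ((2 * cRe z ^+ 2 + 1) * b * X ^+ 2 + 2 * t ^+ 2 * cIm z ^+ 2).
  by rewrite /b; field.
have h1 : (X + t * cRe z) ^+ 2 + (X - t * cRe z) ^+ 2 = 2 * X ^+ 2 + 2 * (t * cRe z) ^+ 2 by ring.
have h2 := sqr_ge0 (X - t * cRe z).
have h3 : 0 <= (2 * cRe z ^+ 2 + 1) * b * X ^+ 2 + 2 * t ^+ 2 * cIm z ^+ 2.
  by apply: addr_ge0; rewrite mulr_ge0 ?sqr_ge0 // mulr_ge0 // sqr_ge0.
by rewrite -h1; lra.
Qed.

Variables (g z tau : C) (a : R).
Hypotheses (g0 : g != 0) (z0 : cIm z != 0) (tau0 : 0 < cIm tau) (a0 : 0 < a).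

Lemma nsq_theta_term x : nsq (theta_term a tau x) =
  nsq x * expR (- (2 * pi * cIm tau * a * nsq x)) ^+ 2.
Proof.
rewrite /theta_term nsqM /eC nsq_expC; congr (_ * expR _ ^+ 2).
have -> : toC (2 * pi) * iC R * (tau * toC (a * nsq x)) =
  toC (2 * pi * a * nsq x) * (iC R * tau) by rewrite !toCM; ring.
rewrite cReM cRe_toC cIm_toC mul0r subr0 cReM.
have -> : cRe (iC R) = 0 by [].
have -> : cIm (iC R) = 1 by [].
by ring.
Qed.

Lemma latt_point_bound (y : R * R) : exists2 K : R, 0 <= K & forall k : int * int,
  (1 + k.1%:~R ^+ 2 <= K * (1 + nsq (latt_point g z (shift y k)))) /\
  (1 + k.2%:~R ^+ 2 <= K * (1 + nsq (latt_point g z (shift y k)))).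
Proof.
have [K1 K10 hK1] := nsq_latt_bound z0.
have ng0 : 0 < nsq g by rewrite nsq_gt0.
pose K2 := 2 * (K1 / nsq g).
have K20 : 0 <= K2 by rewrite /K2 mulr_ge0 // divr_ge0 // ltW.
(* Undoing the shift costs [i^2 <= 2 (y_1 + i)^2 + 2 y_1^2], and likewise for the second coordinate;
   [K2 / 2] is the constant for the shifted squares. *)
exists (1 + 2 * y.1 ^+ 2 + 2 * y.2 ^+ 2 + K2).
  by rewrite addr_ge0 // !addr_ge0 // mulr_ge0 // sqr_ge0.
move=> k; set q := nsq _; have q0 : 0 <= q := nsq_ge0 _.
have := hK1 (shift y k).1 (shift y k).2.
have -> : K1 * nsq (toC (shift y k).1 - toC (shift y k).2 * z) = K2 / 2 * q.
  by rewrite /q /latt_point nsqM /K2; field; rewrite gt_eqF.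
rewrite /shift /=; set i : R := k.1%:~R; set j : R := k.2%:~R => h.
have y1 := sqr_ge0 y.1; have y2 := sqr_ge0 y.2.
have hi := sqr_ge0 (y.1 + i); have hj := sqr_ge0 (y.2 + j).
have ei : i ^+ 2 <= 2 * (y.1 + i) ^+ 2 + 2 * y.1 ^+ 2.
  by rewrite -subr_ge0 (_ : _ - _ = (2 * y.1 + i) ^+ 2) ?sqr_ge0 //; ring.
have ej : j ^+ 2 <= 2 * (y.2 + j) ^+ 2 + 2 * y.2 ^+ 2.
  by rewrite -subr_ge0 (_ : _ - _ = (2 * y.2 + j) ^+ 2) ?sqr_ge0 //; ring.
have m1 : 0 <= y.1 ^+ 2 * q by rewrite mulr_ge0.
have m2 : 0 <= y.2 ^+ 2 * q by rewrite mulr_ge0.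
have -> : (1 + 2 * y.1 ^+ 2 + 2 * y.2 ^+ 2 + K2) * (1 + q) =
  1 + 2 * y.1 ^+ 2 + 2 * y.2 ^+ 2 + K2 + q + 2 * (y.1 ^+ 2 * q) + 2 * (y.2 ^+ 2 * q) + K2 * q by ring.
have h' : (y.1 + i) ^+ 2 + (y.2 + j) ^+ 2 <= (K2 * q) / 2 by rewrite mulrAC in h.
by split; lra.
Qed.

Lemma theta_term_bound (y : R * R) : exists2 K : R, 0 <= K & forall k : int * int,
  let h := K * ((1 + (k.1%:~R : R) ^+ 2) * (1 + (k.2%:~R : R) ^+ 2))^-1 in
  `|cRe (theta_term a tau (latt_point g z (shift y k)))| <= h /\
  `|cIm (theta_term a tau (latt_point g z (shift y k)))| <= h.
Proof.
have c0 : 0 < 2 * pi * cIm tau * a by rewrite !mulr_gt0 // pi_gt0.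
have [K1 K10 hK1] := cube_exp_bound c0; have [K2 K20 hK2] := latt_point_bound y.
exists (K1 * K2 ^+ 2); first by rewrite mulr_ge0 // sqr_ge0.
move=> k h; have [h1 h2] := hK2 k; set x := latt_point _ _ _ in h1 h2 *.
have q0 := nsq_ge0 x; set q := nsq x in q0 h1 h2.
have e0 := expR_ge0 (- (2 * pi * cIm tau * a * q)).
have key : (1 + q) * expR (- (2 * pi * cIm tau * a * q)) <= h.
  have p1 : 0 < 1 + (k.1%:~R : R) ^+ 2 by rewrite ltr_wpDr // sqr_ge0.
  have p2 : 0 < 1 + (k.2%:~R : R) ^+ 2 by rewrite ltr_wpDr // sqr_ge0.
  rewrite /h ler_pdivlMr ?mulr_gt0 //.
  apply: (@le_trans _ _ ((1 + q) * expR (- (2 * pi * cIm tau * a * q)) *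
     ((K2 * (1 + q)) * (K2 * (1 + q))))).
    apply: ler_wpM2l; first by rewrite mulr_ge0 // addr_ge0.
    by apply: ler_pM => //; exact: ltW.
  have -> : (1 + q) * expR (- (2 * pi * cIm tau * a * q)) * ((K2 * (1 + q)) * (K2 * (1 + q))) =
    ((1 + q) ^+ 3 * expR (- (2 * pi * cIm tau * a * q))) * K2 ^+ 2 by ring.
  by apply: ler_wpM2r; [exact: sqr_ge0|exact: hK1].
have [hr hi] : `|cRe (theta_term a tau x)| <= (1 + q) * expR (- (2 * pi * cIm tau * a * q)) /\
   `|cIm (theta_term a tau x)| <= (1 + q) * expR (- (2 * pi * cIm tau * a * q)).
  apply: abs_Re_Im_le; first by rewrite mulr_ge0 // addr_ge0.
  rewrite nsq_theta_term exprMn -/q; apply: ler_wpM2r; first exact: sqr_ge0.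
  by rewrite -subr_ge0 (_ : _ - _ = 1 + q + q ^+ 2) ?addr_ge0 ?sqr_ge0 //; ring.
by split; [exact: le_trans hr key|exact: le_trans hi key].
Qed.

Lemma theta_exhausting (y : R * R) : exists l : C, forall S, exhausting S ->
  ccvg (fun M => \sum_(k <- S M) theta_term a tau (latt_point g z (shift y k))) l.
Proof.
have [K K0 hK] := theta_term_bound y.
pose h (k : int * int) : R := K * ((1 + (k.1%:~R : R) ^+ 2) * (1 + (k.2%:~R : R) ^+ 2))^-1.
have hB M : \sum_(k <- ibox M) h k <= K * 25.
  by rewrite -mulr_sumr ler_wpM2l // sum_ibox_inv_sq_le.
have [lr hr] := exhausting_cvg_abs (fun k => proj1 (hK k)) hB.
have [li hi] := exhausting_cvg_abs (fun k => proj2 (hK k)) hB.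
exists (lr +i* li)%C => S hS; split.
  by under eq_fun => n do rewrite cRe_sum; exact: hr.
by under eq_fun => n do rewrite cIm_sum; exact: hi.
Qed.

Lemma latt_point_shift_inj (y : R * R) : injective (fun k => latt_point g z (shift y k)).
Proof.
move=> [i j] [i' j'] /(mulfI g0); rewrite /shift /= !toCD !toC_int => e.
have [|e1 e2] := @latt_inj R z i (- j) i' (- j') z0.
  rewrite !intrN; transitivity (toC y.1 + i%:~R - (toC y.2 + j%:~R) * z - (toC y.1 - toC y.2 * z)).
    by ring.
  by rewrite e; ring.
by rewrite e1; congr pair; exact: oppr_inj.
Qed.

(** Pulled back to integer coordinates, the discs form an exhausting sequence: a box has finitely
    many points, so it lies in every sufficiently large disc. *)
Lemma theta_discs (y : R * R) : exists l : C,
  ccvg (fun M => \sum_(k <- ibox M) theta_term a tau (latt_point g z (shift y k))) l /\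
  forall X : nat -> seq C, (forall M, uniq (X M)) ->
    (forall M x, x \in X M <-> (exists k, x = latt_point g z (shift y k)) /\ a * nsq x < M%:R) ->
    ccvg (fun M => \sum_(x <- X M) theta_term a tau x) l.
Proof.
have [l hl] := theta_exhausting y; exists l; split; first by apply: hl; exact: exhausting_ibox.
move=> X uX mX.
(* Chooses coordinates for every complex number; the default [(0, 0)] is met only off the shifted
   lattice. *)
have hk x : exists k, (exists k, x = latt_point g z (shift y k)) -> x = latt_point g z (shift y k).
  by case: (pselect (exists k, x = latt_point g z (shift y k))) => [[k e]|n]; [exists k|exists (0, 0)].
have [kf kfP] := choice hk.
have kfK M x : x \in X M -> latt_point g z (shift y (kf x)) = x.
  by case/mX => /kfP.
have -> : (fun M => \sum_(x <- X M) theta_term a tau x) =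
    (fun M => \sum_(k <- map kf (X M)) theta_term a tau (latt_point g z (shift y k))).
  apply: funext => M; rewrite big_map big_seq [RHS]big_seq.
  by apply: eq_bigr => x xM; rewrite (kfK M).
apply: hl; split=> [M|n].
  by rewrite map_inj_in_uniq // => x x' xM xM' e; rewrite -(kfK _ _ xM) e (kfK _ _ xM').
have [M0 hM0] : exists M0 : nat, forall k, k \in ibox n -> a * nsq (latt_point g z (shift y k)) < M0%:R.
  elim: (ibox n) => [|k s [M0 IH]]; first by exists 0%N.
  exists (maxn M0 (Num.bound (a * nsq (latt_point g z (shift y k))))) => k'; rewrite inE => /orP[/eqP ->|/IH h].
    apply: (@lt_le_trans _ _ (Num.bound (a * nsq (latt_point g z (shift y k))))%:R).
      by rewrite archi_boundP // mulr_ge0 ?nsq_ge0 // ltW.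
    by rewrite ler_nat leq_maxr.
  by apply: (lt_le_trans h); rewrite ler_nat leq_maxl.
exists M0 => M MM k kn; apply/mapP.
have kX : latt_point g z (shift y k) \in X M.
  apply/mX; split; first by exists k.
  by apply: lt_le_trans (hM0 k kn) _; rewrite ler_nat.
exists (latt_point g z (shift y k)) => //; apply: (@latt_point_shift_inj y); rewrite (kfK _ _ kX) //.
Qed.

End LatticeTheta.

(** * The functions [f_a] as sums over cosets of [gamma b_z] *)

Section OmegaMap.
Variables (R : realType) (D : int).
Hypotheses (hD : fund_disc D) (hDneg : D < 0).
Local Notation C := (R[i]).
Local Notation O := (@OK R D).
Variable (f : nat).
Hypothesis (hf : (0 < f)%N).
Local Notation gam := (f%:R * sqrtD R D : C).
Variable p : cmpt R.
Hypothesis hp : CM_point D p.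
Local Notation z := (cz p).
Local Notation A := (cA p).
Local Notation B := (cB p).
Local Notation Cc := (cC p).
Local Notation b := (latt_z z).
Local Notation N := (f * `|D|)%N.

Lemma f_gt0R : 0 < (f%:R : R). Proof. by rewrite ltr0n. Qed.
Lemma absD : (`|D|%N%:R : R) = - D%:~R.
Proof. by rewrite natr_absz ltr0_norm // intrN. Qed.
Lemma nsq_gam : nsq gam = f%:R ^+ 2 * - D%:~R.
Proof. by rewrite nsqM nsq_sqrtD // -toC_nat nsq_toC. Qed.
Lemma cardGE : cardG f p = f%:R ^+ 2 * - D%:~R.
Proof.
rewrite /cardG -(disc_form hDneg hp); congr (_ * _).
rewrite intrB !intrM; have -> : (4 : int)%:~R = 4 :> R by [].
by ring.
Qed.
Lemma sqrt2Af_gt0 : 0 < Num.sqrt (2 * A%:~R * f%:R : R).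
Proof. by rewrite sqrtr_gt0 !mulr_gt0 ?f_gt0R ?(cA_gt0R hp). Qed.
(** [|G_Lambda| = f^2 |D|], so [i sqrt(|G_Lambda|)] is [f sqrt(D) = gam]: in coordinates, [Omega] is
    multiplication by [gam]. *)
Lemma kappaE : kappa f p * toC (Num.sqrt (2 * A%:~R * f%:R)) = gam.
Proof.
rewrite /kappa toCV mulfVK; last by rewrite -[0]/(toC 0) (inj_eq (@toC_inj R)) gt_eqF // sqrt2Af_gt0.
rewrite cardGE sqrtrM ?sqr_ge0 // sqrtr_sqr ger0_norm ?ler0n // toCM toC_nat mulrCA; congr (_ * _).
by apply: cext; rewrite /iC /toC /sqrtD /=; ring.
Qed.
Lemma kappa_neq0 : kappa f p != 0.
Proof.
have := (gam_neq0 R hDneg hf); rewrite -kappaE mulf_eq0 negb_or; by case/andP.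
Qed.
(** The right-hand side is the same for all CM points. Combined with [|psi|^2 = A], this makes the
    coefficients of the different [f_a] equal in absolute value. *)
Lemma nsq_kappa : nsq (kappa f p) * A%:~R = f%:R * - D%:~R / 2.
Proof.
have := congr1 (@nsq R) kappaE; rewrite nsqM nsq_toC sqr_sqrtr; last first.
  by rewrite !mulr_ge0 // ltW // (cA_gt0R hp).
rewrite nsq_gam => e; have f0 := f_gt0R; have fn0 : (f%:R : R) != 0 by rewrite gt_eqF.
apply: (mulIf fn0).
transitivity (nsq (kappa f p) * (2 * A%:~R * f%:R) / 2); first by field.
by rewrite e; field.
Qed.
Lemma OmegaE v : Omega f p v = latt_point gam z v.
Proof. by rewrite /Omega /Omega' mulrA kappaE. Qed.
Lemma OmegaInvK x : Omega f p (OmegaInv f p x) = x.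
Proof.
rewrite OmegaE /latt_point /OmegaInv kappaE /=; set w := x / gam.
have -> : x = gam * w by rewrite /w mulrCA divff ?mulr1 // (gam_neq0 R hDneg hf).
have z0 := cIm_cz_neq0 hp.
by congr (_ * _); apply: cext; rewrite !cE; [ring|field].
Qed.
Lemma act_OmegaInv al x : act f p al (OmegaInv f p x) = OmegaInv f p (al * x).
Proof. by rewrite /act OmegaInvK. Qed.

(** The coordinates on [1] and [z] are the values of [bil] against [e_1] and [e_2], which is why the
    dual lattice corresponds to [b_z]. *)
Lemma Omega_coords (s t : R) : Omega f p (s, t) =
  toC (f%:R * (B%:~R * s + 2 * Cc%:~R * t)) + toC (f%:R * (2 * A%:~R * s + B%:~R * t)) * z.
Proof.
rewrite OmegaE /latt_point /= (sqrtD_cz hDneg hp) !(toCM, toCD, toC_nat, toC_int).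
transitivity (f%:R * (2 * A%:~R * toC s * z + B%:~R * toC s - B%:~R * toC t * z
   - 2 * toC t * (A%:~R * z ^+ 2))); first by ring.
by rewrite (cz_sq hp); ring.
Qed.

Lemma in_dual_OmegaInv x : b x -> in_dual f p (OmegaInv f p x).
Proof.
move=> [m [n xE]]; case e : (OmegaInv f p x) => [s t].
have := OmegaInvK x; rewrite e Omega_coords xE -!toC_int => E.
have z0 := cIm_cz_neq0 hp.
have := congr1 (@cIm R) E; rewrite !cE !mul0r !addr0 !add0r => /(mulIf z0) en.
have := congr1 (@cRe R) E; rewrite !cE en !mul0r !subr0 => /addIr em.
move=> k l; exists (n * k + m * l); rewrite /bil /= intrD !intrM -en -em.
by ring.
Qed.

Lemma same_coset_Omega y1 y2 : same_coset y1 y2 ->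
  exists v, b v /\ Omega f p y1 = Omega f p y2 + gam * v.
Proof.
move=> [[m /= hm] [n /= hn]]; exists (m%:~R - n%:~R * z); split.
  by exists m, (- n); rewrite intrN mulNr.
have -> : y1 = (y2.1 + m%:~R, y2.2 + n%:~R).
  by case: y1 y2 hm hn => a1 a2 [b1 b2] /= <- <-; rewrite !subrKC.
by rewrite !OmegaE /latt_point /= !toCD !toC_int; ring.
Qed.

(** Turns the exponent [pi i N tau (y, y)] of [fa] into [2 pi i tau] times the norm of the ideal
    [x b_z^-1], where [x = Omega y]. *)
Lemma bil_nsq v : N%:R * bil f p v v = 2 * (A%:~R * nsq (Omega f p v)).
Proof.
have e : A%:~R * nsq (toC v.1 - toC v.2 * z) =
    A%:~R * v.1 ^+ 2 + B%:~R * v.1 * v.2 + Cc%:~R * v.2 ^+ 2.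
  rewrite -(nsq_cz hp).
  have -> : B%:~R = - (2 * (A%:~R * cRe z)) :> R by rewrite (cRe_cz hp) opprK.
  by rewrite /nsq !cE; ring.
rewrite OmegaE /latt_point nsqM nsq_gam natrM absD /bil.
transitivity (2 * f%:R ^+ 2 * - D%:~R * (A%:~R * nsq (toC v.1 - toC v.2 * z))); last by ring.
by rewrite e; ring.
Qed.

Lemma fa_partialE y tau M : kappa f p * fa_partial f N p y tau M =
  \sum_(k <- ibox M) theta_term A%:~R tau (latt_point gam z (shift y k)).
Proof.
rewrite sum_ibox /fa_partial mulr_sumr; apply: eq_bigr => i _.
rewrite mulr_sumr; apply: eq_bigr => j _ /=.
set v := (_, _).
have vE : v = shift y (i%:Z - M%:Z, j%:Z - M%:Z) by rewrite /v /shift /= !intrB.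
rewrite mulrA -/(Omega f p v) -vE -OmegaE /theta_term; congr (_ * _).
rewrite /eC; congr expC.
transitivity (toC pi * iC R * tau * toC (N%:R * bil f p v v)); first by rewrite toCM; ring.
by rewrite bil_nsq !toCM; ring.
Qed.

Lemma fa_discs (x0 tau : C) (X : nat -> seq C) : 0 < cIm tau ->
  (forall M, uniq (X M)) ->
  (forall M x, x \in X M <-> (exists v, b v /\ x = x0 + gam * v) /\ A%:~R * nsq x < M%:R) ->
  ccvg (fun M => \sum_(x <- X M) theta_term A%:~R tau x)
    (kappa f p * fa f N p (OmegaInv f p x0) tau).
Proof.
move=> tau0 uX mX.
have [l [hl hX]] := theta_discs (gam_neq0 R hDneg hf) (cIm_cz_neq0 hp) tau0 (cA_gt0R hp) (OmegaInv f p x0).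
have {hl} hl : ccvg (fa_partial f N p (OmegaInv f p x0) tau) ((kappa f p)^-1 * l).
  have := ccvgZ (kappa f p)^-1 hl; congr (ccvg _ _); apply: funext => M.
  by rewrite -fa_partialE mulKf // kappa_neq0.
rewrite /fa (ccvg_clim hl) mulVKf ?kappa_neq0 //; apply: hX => // M x.
rewrite mX; split=> -[[v e] h]; split=> //.
  case: e => -[m [n ->]] ->; exists (m, - n); rewrite -{1}(OmegaInvK x0) OmegaE /latt_point /shift /=.
  by rewrite !toCD !toC_int intrN; ring.
exists (v.1%:~R - v.2%:~R * z); split; first by exists v.1, (- v.2); rewrite intrN mulNr.
by rewrite -{1}(OmegaInvK x0) OmegaE e /latt_point /shift /= !toCD !toC_int; ring.
Qed.

End OmegaMap.

(** * The theta series as a sum over lattice points *)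

Section FiniteLists.
Variable R : realType.
Local Notation C := (R[i]).

Lemma latt_disc_seq (z : C) (r : R) : cIm z != 0 ->
  exists s : seq C, uniq s /\ forall x, x \in s <-> latt_z z x /\ nsq x < r.
Proof.
move=> z0; have [K K0 hK] := nsq_latt_bound z0.
pose n0 := Num.bound (K * `|r|); pose pt (k : int * int) : C := k.1%:~R + k.2%:~R * z.
have pt_inj : injective pt.
  by move=> [i j] [i' j'] /(latt_inj z0) /= [-> ->].
exists [seq x <- map pt (ibox n0) | nsq x < r]; split.
  by rewrite filter_uniq // map_inj_uniq // uniq_ibox.
move=> x; rewrite mem_filter; split=> [/andP[h /mapP[[m n] _ xE]]|[[m [n xE]] h]].
  by split=> //; exists m, n.
rewrite h andTb; apply/mapP; exists (m, n); last exact: xE.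
have hb := hK m%:~R ((- n)%:~R).
have {hb} : (m%:~R : R) ^+ 2 + n%:~R ^+ 2 <= K * nsq x.
  by move: hb; rewrite !toC_int xE !intrN sqrrN mulNr opprK.
have h1 : K * nsq x <= K * `|r| by apply: ler_wpM2l => //; apply: ltW; apply: lt_le_trans h (ler_norm r).
have h2 : K * `|r| < n0%:R by apply: archi_boundP; rewrite mulr_ge0.
move=> h3; have : (m%:~R : R) ^+ 2 + n%:~R ^+ 2 < n0%:~R.
  exact: le_lt_trans h3 (le_lt_trans h1 h2).
rewrite -!rmorphXn -intrD ltr_int mem_ibox /= !expr2 => h4.
by apply/andP; split; nia.
Qed.

(** A new element is kept unless it is related in both directions to one already kept. The last
    clause likewise assumes both directions, so reflexivity of [e] suffices. *)
Lemma transversal_seq (T : eqType) (e : T -> T -> Prop) (s : seq T) :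
  (forall x, e x x) -> exists t : seq T, [/\ uniq t, {subset t <= s},
    forall x, x \in s -> exists2 y, y \in t & e x y
    & forall x y, x \in t -> y \in t -> e x y -> e y x -> x = y].
Proof.
move=> exx; elim: s => [|a s [t [ut ts cov inj]]]; first by exists [::].
case: (pselect (exists2 y, y \in t & e a y /\ e y a)) => [[y yt [ay _]]|n].
  exists t; split=> // [x /ts|x]; first by rewrite inE orbC => ->.
  by rewrite inE => /orP[/eqP ->|/cov]; first by exists y.
have at' : a \notin t by apply/negP => h; apply: n; exists a.
exists (a :: t); split.
- by rewrite /= at' ut.
- by move=> x; rewrite !inE => /orP[->//|/ts ->]; rewrite orbT.
- move=> x; rewrite inE => /orP[/eqP ->|/cov[y yt xy]]; first by exists a; rewrite ?mem_head.
  by exists y => //; rewrite inE yt orbT.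
- move=> x y; rewrite !inE => /orP[/eqP ->|xt] /orP[/eqP ->|yt] // h1 h2.
  + by case: n; exists y.
  + by case: n; exists x.
  + exact: inj.
Qed.

(** A unit has [nsq u = 1], so the lattice points with [nsq] below 2 include all units. *)
Lemma unit_seq (D : int) : fund_disc D -> D < 0 ->
  exists U : seq C, uniq U /\ forall u, u \in U <-> unitOK D u.
Proof.
move=> hD hDneg; have [s [us hs]] := latt_disc_seq 2 (cIm_omega_neq0 R hDneg).
exists [seq u <- s | `[< unitOK D u >]]; split; first by rewrite filter_uniq.
move=> u; rewrite mem_filter; split=> [/andP[/asboolP]//|hu].
apply/andP; split; first exact/asboolP.
apply/hs; case: hu => hO [u0 hV]; split=> //.
rewrite (@OK_unit_real R D hDneg (nsq u)) ?nsq_gt0 //; first lra.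
  by rewrite -mulcJ; apply: OKM => //; exact: OKJ.
by rewrite -nsqV -mulcJ; apply: OKM => //; exact: OKJ.
Qed.

End FiniteLists.

(** * From integral ideals to lattice points, and the average over the CM group *)

Section Theta.
Variables (R : realType) (D : int).
Hypotheses (hD : fund_disc D) (hDneg : D < 0).
Local Notation C := (R[i]).
Local Notation w := (omega R D).
Local Notation O := (@OK R D).
Local Notation ideal := (@is_int_ideal R D).
Variable (f : nat).
Hypothesis (hf : (0 < f)%N).
Local Notation gam := (f%:R * sqrtD R D : C).
Local Notation N := (f * `|D|)%N.
Variable zs : seq (cmpt R).
Hypothesis hzs : forall p, p \in zs -> CM_point D p.
Local Notation zn i := (nth (CMpt 0 0 0 0) zs i).
Hypothesis hdistinct : forall i j, (i < size zs)%N -> (j < size zs)%N -> i <> j ->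
     ~ homothetic (latt_z (cz (zn i))) (latt_z (cz (zn j))).
Hypothesis hcomplete : forall L : set C, is_lattice L -> CM_by_OK D L ->
     exists2 p, p \in zs & homothetic L (latt_z (cz p)).

Definition gam_congr (p : cmpt R) (x y : C) : Prop :=
  exists v, latt_z (cz p) v /\ x = y + gam * v.

Lemma gam_congr_refl p x : gam_congr p x x.
Proof. by exists 0; split; [exact: latt0|ring]. Qed.
Lemma gam_congr_sym p x y : gam_congr p x y -> gam_congr p y x.
Proof. by move=> [v [hv ->]]; exists (- v); split; [exact: lattN|ring]. Qed.
Lemma gam_congr_trans p x y t : gam_congr p x y -> gam_congr p y t -> gam_congr p x t.
Proof. by move=> [v [hv ->]] [v' [hv' ->]]; exists (v' + v); split; [exact: lattD|ring]. Qed.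
Lemma gam_congrM p a x y : CM_point D p -> O a -> gam_congr p x y -> gam_congr p (a * x) (a * y).
Proof. by move=> hp ha [v [hv ->]]; exists (a * v); split; [exact: (lattO hp)|ring]. Qed.
Lemma gam_congr_prin p a a' x : CM_point D p -> latt_z (cz p) x -> prin D gam (a - a') ->
  gam_congr p (a * x) (a' * x).
Proof.
move=> hp hx [d [hd e]]; exists (d * x); split; first exact: (lattO hp).
by rewrite mulrA -e; ring.
Qed.

Definition is_reps (p : cmpt R) (t : seq C) : Prop := [/\ uniq t,
  forall x, x \in t -> latt_z (cz p) x,
  forall x, latt_z (cz p) x -> exists2 y, y \in t & gam_congr p x y
  & forall x y, x \in t -> y \in t -> gam_congr p x y -> x = y].

(** [N = - gam * sqrtD], so [N b_z] lies in [gam b_z]; the points with both coordinates in [[0, N)]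
    meet every coset, and a transversal of them is extracted. *)
Lemma coset_reps p : CM_point D p -> exists t : seq C, is_reps p t.
Proof.
move=> hp; have D0 : (0 < N)%N by rewrite muln_gt0 hf absz_gt0 lt_eqF.
pose s : seq C := [seq i%:Z%:~R + j%:Z%:~R * cz p | i <- iota 0 N, j <- iota 0 N].
have [t [ut ts cov inj]] := transversal_seq s (gam_congr_refl p).
exists t; split=> //.
- by move=> x /ts/allpairsP[[i j] [_ _ ->]]; exists i, j.
- move=> x [m [n ->]].
  have Nn0 : (N%:Z != 0) by lia.
  have hm := modz_ge0 m Nn0; have hn := modz_ge0 n Nn0.
  have hm' : (m %% N)%Z < N by apply: ltz_pmod; lia.
  have hn' : (n %% N)%Z < N by apply: ltz_pmod; lia.
  have ys : (m %% N)%Z%:~R + (n %% N)%Z%:~R * cz p \in s.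
    apply/allpairsP; exists (absz (m %% N)%Z, absz (n %% N)%Z).
    rewrite /= !mem_iota !gez0_abs //; split=> //; rewrite /= -ltz_nat add0n gez0_abs //.
  have [y yt ye] := cov _ ys; exists y => //; apply: gam_congr_trans ye.
  pose v := (m %/ N)%Z%:~R + (n %/ N)%Z%:~R * cz p.
  exists (- sqrtD R D * v); split.
    apply: (lattO hp); first by apply: OKN; exact: OK_sqrtD.
    by exists (m %/ N)%Z, (n %/ N)%Z.
  have gN : gam * - sqrtD R D = N%:R.
    rewrite mulrN -mulrA -expr2 sqrtD_sq // natrM -mulrN; congr (_ * _).
    by rewrite natr_absz ltr0_norm // intrN.
  rewrite mulrA gN {1}(divz_eq m N) {1}(divz_eq n N) !intrD !intrM /v.
  by rewrite -[N%:R]/(N%:Z%:~R); ring.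
- by move=> x y hx hy h; apply: inj => //; exact: gam_congr_sym.
Qed.

Variables (chi : C -> C) (cf : set C) (phi : set C -> C) (chi' : C -> C).
Hypothesis hchiu : forall u, unitOK D u -> chi u = u.
Hypothesis hcf : prin D gam `<=` cf.
Hypothesis hphi : is_hecke D cf phi chi'.
Hypothesis hpull : forall a, elt_coprime D (prin D gam) a -> chi' a = (chi a)^-1.
Local Notation psi := (psi cf phi).

Let zn_in i : (i < size zs)%N -> zn i \in zs. Proof. exact: mem_nth. Qed.

Definition hnf_triple M (t : 'I_M * 'I_M * 'I_M) : set C :=
  @hnf R D t.1.2 t.2 (t.1.1 %/ t.1.2).
(** The components are the norm [n] and the Hermite parameters [a], [b]. The definition is used at
    [M.+1], where [M.-1] restores the bound [n < M] of [theta_partial]; the extra room keeps the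
    type inhabited when [M = 0]. *)
Definition ideal_triple M (t : 'I_M * 'I_M * 'I_M) : bool :=
  [&& (0 < t.1.1)%N, (t.1.1 < M.-1)%N, (0 < t.1.2)%N, (t.1.2 %| t.1.1)%N, (t.2 < t.1.2)%N
    & `[< ideal (hnf_triple t) >]].

Lemma theta_partial_triples tau M : theta_partial D cf phi tau M =
  \sum_(t : 'I_M.+1 * 'I_M.+1 * 'I_M.+1 | ideal_triple t)
    phi_ext cf phi (hnf_triple t) * eC (tau * t.1.1%:R).
Proof.
pose F n a b : C := (if pselect (ideal (@hnf R D a b (n %/ a))) then
         phi_ext cf phi (@hnf R D a b (n %/ a)) else 0) * eC (tau * n%:R).
transitivity (\sum_(n < M.+1 | (0 < n)%N && (n < M)%N) \sum_(a < M.+1 | (0 < a)%N && (a %| n)%N)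
   \sum_(b < M.+1 | (b < a)%N) F n a b).
  rewrite /theta_partial big_geq_mkord (big_ord_widen_cond M.+1 (fun n => (1 <= n)%N)
    (fun n => \sum_(a < n.+1 | (0 < a)%N && (a %| n)%N) \sum_(b < a) F n a b)) //.
  apply: eq_bigr => n /andP[n0 nM].
  rewrite (big_ord_widen_cond M.+1 (fun a => (0 < a)%N && (a %| n)%N)
    (fun a => \sum_(b < a) F n a b)) //.
  apply: eq_big => [a|a /andP[/andP[a0 an] aM]].
    by case: (boolP (a %| n)%N); rewrite ?andbF //= => /(dvdn_leq n0); rewrite -ltnS => ->; rewrite !andbT.
  by rewrite (big_ord_widen M.+1 (fun b => F n a b)) // ltnW.
rewrite pair_big_dep pair_big_dep /= big_mkcond [RHS]big_mkcond; apply: eq_bigr => -[[n a] b] _ /=.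
rewrite /ideal_triple /hnf_triple /F /=.
by case: pselect => h; [rewrite asboolT|rewrite asboolF]; rewrite // ?andbT ?andbF ?mul0r ?if_same // !andbA.
Qed.

Lemma hnf_triple_inj M (t t' : 'I_M * 'I_M * 'I_M) : ideal_triple t -> ideal_triple t' ->
  hnf_triple t = hnf_triple t' -> t = t'.
Proof.
case: t t' => [[n a] b] [[n' a'] b'] /and5P[/= n0 _ a0 an /andP[ba _]].
move=> /and5P[/= n0' _ a0' an' /andP[ba' _]] e.
have c0 : (0 < n %/ a)%N by rewrite divn_gt0 // dvdn_leq.
have c0' : (0 < n' %/ a')%N by rewrite divn_gt0 // dvdn_leq.
have [ea eb ec] := hnf_inj hDneg a0 ba c0 a0' ba' c0' e.
have en : n = n' :> nat by rewrite -(divnK an) -(divnK an') ec ea.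
by congr (_, _, _); apply: val_inj.
Qed.

Lemma quot_ideal_triple M i x : (i < size zs)%N -> latt_z (cz (zn i)) x -> x != 0 ->
  (cA (zn i))%:~R * nsq x < M%:R ->
  exists t : 'I_M.+1 * 'I_M.+1 * 'I_M.+1, [/\ ideal_triple t, quot_ideal (zn i) x = hnf_triple t
    & t.1.1%:R = (cA (zn i))%:~R * nsq x].
Proof.
move=> iz hx x0 hM; have hp := hzs (zn_in iz).
have hI := quot_ideal_ideal hD hDneg hp hx x0.
have [a [b [c [a0 ba c0 e]]]] := hnf_exists hD hDneg hI.
have eN := quot_ideal_hnf hDneg hp e.
have acM : (a * c < M)%N by rewrite -(ltr_nat R) eN.
have nM : (a * c < M.+1)%N by exact: ltnW.
have aM : (a < M.+1)%N by apply: leq_ltn_trans nM; rewrite leq_pmulr.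
have bM : (b < M.+1)%N by exact: ltn_trans aM.
have eJ : quot_ideal (zn i) x = hnf_triple (Ordinal nM, Ordinal aM, Ordinal bM).
  by rewrite e /hnf_triple /= mulKn.
exists (Ordinal nM, Ordinal aM, Ordinal bM); split=> //.
rewrite /ideal_triple -eJ /= muln_gt0 a0 c0 acM dvdn_mulr // ba /=.
exact/asboolP.
Qed.

(** Sorts the pairs of a CM point and a lattice point by the ideal they define; each ideal is hit
    once per unit, whence the factor [size U]. *)
Lemma theta_points tau M (U : seq C) (X : nat -> seq C) :
  uniq U -> (forall u, u \in U <-> unitOK D u) ->
  (forall i, (i < size zs)%N -> uniq (X i)) ->
  (forall i, (i < size zs)%N -> forall x,
     x \in X i <-> latt_z (cz (zn i)) x /\ (cA (zn i))%:~R * nsq x < M%:R) ->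
  (size U)%:R * theta_partial D cf phi tau M =
  \sum_(i <- iota 0 (size zs)) \sum_(x <- X i) psi (zn i) x * theta_term (cA (zn i))%:~R tau x.
Proof.
move=> uU mU uX mX.
pose P : seq (nat * C) := [seq (i, x) | i <- iota 0 (size zs), x <- [seq x <- X i | x != 0]].
pose G (e : nat * C) := psi (zn e.1) e.2 * theta_term (cA (zn e.1))%:~R tau e.2.
have mP e : e \in P <-> [/\ (e.1 < size zs)%N, latt_z (cz (zn e.1)) e.2,
    (cA (zn e.1))%:~R * nsq e.2 < M%:R & e.2 != 0].
  split.
    move=> /allpairsPdep[i [x [iz xX ->]]] /=; move: iz xX; rewrite mem_iota mem_filter add0n /=.
    by move=> iz /andP[x0 /(mX _ iz)[]].
  case: e => i x /= [iz hx hM x0]; apply/allpairsPdep; exists i, x.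
  by rewrite mem_iota mem_filter x0 /=; split=> //; apply/(mX _ iz).
have uP : uniq P.
  apply: allpairs_uniq_dep; rewrite ?iota_uniq //.
    by move=> i; rewrite mem_iota /= => iz; rewrite filter_uniq // uX.
  by move=> [i x] [i' x'] _ _ /= [-> ->].
have -> : \sum_(i <- iota 0 (size zs)) \sum_(x <- X i) psi (zn i) x * theta_term (cA (zn i))%:~R tau x =
    \sum_(e <- P) G e.
  rewrite big_allpairs_dep; apply: eq_bigr => i _; rewrite big_filter [RHS]big_mkcond.
  apply: eq_bigr => x _; case: eqP => // ->.
  by rewrite /theta_term mul0r mulr0.
have hF e : exists t : 'I_M.+1 * 'I_M.+1 * 'I_M.+1, e \in P -> [/\ ideal_triple t,
    quot_ideal (zn e.1) e.2 = hnf_triple t & t.1.1%:R = (cA (zn e.1))%:~R * nsq e.2].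
  case: (boolP (e \in P)) => [/mP[h1 h2 h3 h4]|_]; last by exists (ord0, ord0, ord0).
  by have [t ?] := quot_ideal_triple h1 h2 h4 h3; exists t.
have [F hFP] := choice hF.
rewrite theta_partial_triples mulr_sumr [RHS]big_seq.
rewrite (partition_big F (@ideal_triple M.+1)); last by move=> e /hFP[].
apply: eq_bigr => t ht.
transitivity (\sum_(e <- P | (e \in P) && (F e == t)) phi_ext cf phi (hnf_triple t) * eC (tau * t.1.1%:R)); last first.
  apply: eq_bigr => e /andP[eP /eqP et]; have [_ e1 e2] := hFP e eP; rewrite et in e1 e2.
  have [h1 _ _ _] := (mP e).1 eP.
  rewrite -e1 (phi_ext_psi hD hDneg hf hchiu hcf hphi hpull _ (zn_in h1)) /G /theta_term -mulrA.
  by rewrite -e2 toC_nat.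
rewrite big_const_seq iter_addr_0 -[RHS]mulr_natl; congr (_%:R * _).
have /and5P[n0 nM a0 an /andP[ba /asboolP hI]] := ht.
(* The fibre over [t] is the unit orbit of one point [(i0, x0)]: [hdistinct] forces the index, and
   [quot_ideal_unit] makes the ratio of two points a unit. *)
have [p [x0 [pz bx0 x00 eI]]] := quot_ideal_complete hD hDneg hzs hcomplete hI.
pose i0 := index p zs; have i0z : (i0 < size zs)%N by rewrite index_mem.
have pE : zn i0 = p by rewrite nth_index.
have hp := hzs pz.
rewrite -size_filter -(size_map (fun u => (i0, u * x0))); apply/esym/perm_size/uniq_perm.
- by rewrite filter_uniq.
- by rewrite map_inj_uniq // => u v [/(mulIf x00)].
move=> e; rewrite mem_filter; apply/andP/mapP => [[/andP[eP /eqP et] _]|[u /mU uU' ->]].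
  have [_ e1 _] := hFP e eP; rewrite et eI in e1; have [h1 h2 h3 h4] := (mP e).1 eP.
  have ei : e.1 = i0.
    apply: contrapT => ne; apply: (hdistinct h1 i0z ne); rewrite pE.
    exact: (quot_ideal_homothetic (hzs (zn_in h1)) hp h4 x00 e1).
  exists (e.2 / x0); last by rewrite divfK // -ei; case: (e).
  apply/mU; rewrite ei pE in e1.
  exact: (quot_ideal_unit hp x00 h4 (esym e1)).
have uO : O u by case: uU'.
have eq1 : quot_ideal p (u * x0) = hnf_triple t by rewrite (quot_ideal_mul_unit hp).
have uP' : (i0, u * x0) \in P.
  apply/mP; rewrite /= pE; split=> //; first exact: (lattO hp).
    rewrite -(quot_ideal_hnf hDneg hp eq1) ltr_nat mulnC divnK //.
  by rewrite mulf_neq0 //; case: uU' => _ [].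
split=> //; rewrite uP' /=; have [F1 F2 _] := hFP _ uP'.
apply/eqP; apply: hnf_triple_inj => //.
by rewrite -F2 /= pE.
Qed.

Lemma disc_seqs p : CM_point D p -> exists X : nat -> seq C, forall M,
  uniq (X M) /\ forall x, x \in X M <-> latt_z (cz p) x /\ (cA p)%:~R * nsq x < M%:R.
Proof.
move=> hp.
have h (M : nat) : exists s : seq C, uniq s /\
    forall x, x \in s <-> latt_z (cz p) x /\ (cA p)%:~R * nsq x < M%:R.
  have [s [us ms]] := latt_disc_seq (M%:R / (cA p)%:~R) (cIm_cz_neq0 hp).
  by exists s; split=> // x; rewrite ms ltr_pdivlMr ?(cA_gt0R hp) // mulrC.
by have [X hX] := choice h; exists X.
Qed.

Lemma coset_discs p (X : nat -> seq C) x0 tau : CM_point D p -> latt_z (cz p) x0 ->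
  (forall M, uniq (X M) /\ forall x, x \in X M <-> latt_z (cz p) x /\ (cA p)%:~R * nsq x < M%:R) ->
  0 < cIm tau ->
  ccvg (fun M => \sum_(x <- X M | `[< gam_congr p x x0 >]) theta_term (cA p)%:~R tau x)
    (kappa f p * fa f N p (OmegaInv f p x0) tau).
Proof.
move=> hp hx0 hX tau0; under eq_fun => M do rewrite -big_filter.
apply: (fa_discs hDneg hf hp tau0) => [M|M x]; first by rewrite filter_uniq //; case: (hX M).
rewrite mem_filter; split=> [/andP[/asboolP h /(hX M).2[]]//|[h hM]].
apply/andP; split; first exact/asboolP.
apply/(hX M).2; split=> //; case: h => v [hv ->].
by apply: lattD => //; apply: (lattO hp) => //; exact: gam_OK.
Qed.

(** A change of representative moves the boxes of [fa_partial], but the discs cut from the coset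
    stay the same, so both values are limits of one sequence. *)
Lemma fa_congr p x y tau : CM_point D p -> latt_z (cz p) x -> latt_z (cz p) y ->
  0 < cIm tau -> gam_congr p x y ->
  fa f N p (OmegaInv f p x) tau = fa f N p (OmegaInv f p y) tau.
Proof.
move=> hp hx hy tau0 e; have [X hX] := disc_seqs hp.
apply: (mulfI (kappa_neq0 hDneg hf hp)).
apply: ccvg_unique (coset_discs hp hx hX tau0) _.
have := coset_discs hp hy hX tau0; congr (ccvg _ _); apply: funext => M.
apply: eq_bigl => v; apply: asbool_equiv_eq; split=> h; first exact: (gam_congr_trans h (gam_congr_sym e)).
exact: gam_congr_trans h e.
Qed.

Let psiC p x y : p \in zs -> latt_z (cz p) x -> gam_congr p y x -> psi p x = psi p y.
Proof.
by move=> pz hx [v [hv e]]; apply: (psi_congr hD hDneg hf hzs hchiu hcf hphi hpull pz hx hv e).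
Qed.

Lemma sum_by_reps p (t X : seq C) (g : C -> C) : p \in zs -> is_reps p t ->
  (forall x, x \in X -> latt_z (cz p) x) ->
  \sum_(x <- X) psi p x * g x =
  \sum_(b <- t) psi p b * \sum_(x <- X | `[< gam_congr p x b >]) g x.
Proof.
move=> pz [ut bt ct it] bX.
under [RHS]eq_bigr => b _ do rewrite mulr_sumr big_mkcond.
rewrite exchange_big /= [LHS]big_seq [RHS]big_seq; apply: eq_bigr => x xX.
have [b0 b0t xb0] := ct x (bX x xX).
rewrite (bigD1_seq b0) //= asboolT // big1_seq ?addr0 => [|b /andP[bb0 bt']].
  by rewrite (psiC pz (bt _ b0t) xb0).
case: asboolP => // xb; case/eqP: bb0; apply: it => //.
exact: gam_congr_trans (gam_congr_sym xb) xb0.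
Qed.

Lemma theta_limit (U : seq C) (rp : nat -> seq C) tau :
  uniq U -> (forall u, u \in U <-> unitOK D u) ->
  (forall i, (i < size zs)%N -> is_reps (zn i) (rp i)) -> 0 < cIm tau ->
  ccvg (theta_partial D cf phi tau)
    (\sum_(i <- iota 0 (size zs)) \sum_(b <- rp i)
       (kappa f (zn i) * psi (zn i) b / (size U)%:R) * fa f N (zn i) (OmegaInv f (zn i) b) tau).
Proof.
move=> uU mU hrp tau0.
have U0 : ((size U)%:R : C) != 0.
  have : 1 \in U.
    by apply/mU; split; [exact: OK1|rewrite oner_neq0 invr1; split=> //; exact: OK1].
  by rewrite pnatr_eq0; case: (U).
have hX i : exists X : nat -> seq C, (i < size zs)%N -> forall M, uniq (X M) /\
    forall x, x \in X M <-> latt_z (cz (zn i)) x /\ (cA (zn i))%:~R * nsq x < M%:R.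
  case: (boolP (i < size zs)%N) => [iz|_]; last by exists (fun=> [::]).
  by have [X h] := disc_seqs (hzs (zn_in iz)); exists X.
have [X XP] := choice hX.
have -> : theta_partial D cf phi tau = (fun M => (size U)%:R^-1 *
   \sum_(i <- iota 0 (size zs)) \sum_(b <- rp i) psi (zn i) b *
     \sum_(x <- X i M | `[< gam_congr (zn i) x b >]) theta_term (cA (zn i))%:~R tau x).
  apply: funext => M; apply: (mulfI U0); rewrite mulVKf //.
  rewrite (@theta_points tau M U (fun i => X i M)) //; last first.
  - by move=> i iz; case: (XP i iz M).
  - by move=> i iz; case: (XP i iz M).
  rewrite !big_seq; apply: eq_bigr => i; rewrite mem_iota => /= iz.
  apply: sum_by_reps; [exact: zn_in|exact: hrp|].
  by move=> x /(XP i iz M).2[].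
have -> : \sum_(i <- iota 0 (size zs)) \sum_(b <- rp i)
       (kappa f (zn i) * psi (zn i) b / (size U)%:R) * fa f N (zn i) (OmegaInv f (zn i) b) tau =
   (size U)%:R^-1 * \sum_(i <- iota 0 (size zs)) \sum_(b <- rp i)
       psi (zn i) b * (kappa f (zn i) * fa f N (zn i) (OmegaInv f (zn i) b) tau).
  rewrite mulr_sumr; apply: eq_bigr => i _; rewrite mulr_sumr; apply: eq_bigr => b _.
  by rewrite -!mulrA; ring.
apply: ccvgZ; apply: ccvg_sum => i; rewrite mem_iota => /= iz.
apply: ccvg_sum => b bt; apply: ccvgZ.
have [_ bb _ _] := hrp i iz.
exact: (coset_discs (hzs (zn_in iz)) (bb _ bt) (XP i iz) tau0).
Qed.

(** Multiplication by [al] permutes the cosets of [gam b_z], since [al] is invertible modulo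
    [gam]. *)
Lemma sum_reps_act p (t : seq C) al (P : C -> C) : CM_point D p -> is_reps p t ->
  elt_coprime D (prin D gam) al ->
  (forall x y, latt_z (cz p) x -> latt_z (cz p) y -> gam_congr p x y -> P x = P y) ->
  \sum_(b <- t) P (al * b) = \sum_(b <- t) P b.
Proof.
move=> hp [ut bt ct it] eal hP.
have alO : O al by case: eal.
have hs b : exists b', b \in t -> b' \in t /\ gam_congr p (al * b) b'.
  case: (boolP (b \in t)) => [h|_]; last by exists 0.
  by have [b' h1 h2] := ct _ (lattO hp alO (bt _ h)); exists b'.
have [sg sgP] := choice hs.
transitivity (\sum_(b <- map sg t) P b).
  rewrite big_map [LHS]big_seq [RHS]big_seq; apply: eq_bigr => b h.
  have [h1 h2] := sgP b h; apply: hP => //; last exact: bt.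
  by apply: (lattO hp) => //; exact: bt.
have us : uniq (map sg t).
  rewrite map_inj_in_uniq // => x y hx hy e.
  have [h1 h2] := sgP x hx; have [h3 h4] := sgP y hy; rewrite -e in h4.
  apply: it => //.
  have h5 := gam_congr_trans h2 (gam_congr_sym h4).
  have [a' [[ha' _] h6]] := elt_coprime_inv (ideal_gam R hD hDneg hf) eal.
  have key v : v \in t -> gam_congr p (a' * (al * v)) v.
    move=> hv; rewrite mulrA -{2}[v]mul1r; apply: gam_congr_prin => //; first exact: bt.
    by rewrite [a' * al]mulrC.
  apply: gam_congr_trans (gam_congr_sym (key x hx)) _.
  by apply: gam_congr_trans (key y hy); exact: gam_congrM.
apply: perm_big; apply: uniq_perm => //.
(* An injective self-map of the finite list [t] is onto. *)
have st : {subset map sg t <= t} by move=> _ /mapP[x hx ->]; case: (sgP x hx).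
by have [] := uniq_min_size us st; rewrite size_map.
Qed.

(** Counts the nonzero terms of [gen] before normalisation. As [gen] runs through residues modulo
    [N], this is [|D|] times the order of the CM group. *)
Definition unit_count : nat := (\sum_(u < N) \sum_(v < N)
  if pselect (elt_coprime D (prin D gam) (u%:R + v%:R * w)%R) then 1 else 0)%N.

Lemma unit_count_gt0 : (0 < unit_count)%N.
Proof.
have N1 : (1 < N)%N by have := disc_ge3 hD hDneg; nia.
have N0 : (0 < N)%N by exact: ltnW.
rewrite /unit_count (bigD1 (Ordinal N1)) //= (bigD1 (Ordinal N0)) //=.
case: pselect => // h; case: h; rewrite mul0r addr0.
apply: elt_coprime1; [exact: ideal_gam|exact: OK1|rewrite subrr].
by apply: ideal0; exact: ideal_gam.
Qed.

(** By [psi_act], [psi(b) chi(al)^-1 = psi(al b)]; so after permuting the cosets every [al]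
    contributes the same sum. *)
Lemma sum_reps_gen i (t : seq C) tau : (i < size zs)%N -> is_reps (zn i) t -> 0 < cIm tau ->
  \sum_(b <- t) psi (zn i) b * gen D f (zn i) chi (prin D gam) (OmegaInv f (zn i) b) tau =
  (`|D|%:R)^-1 * unit_count%:R *
    \sum_(b <- t) psi (zn i) b * fa f N (zn i) (OmegaInv f (zn i) b) tau.
Proof.
move=> iz ht tau0; have pz := zn_in iz; have hp := hzs pz; set p := zn i in pz hp ht *.
have [_ bt _ _] := ht.
set Q := \sum_(b <- t) psi p b * fa _ _ _ _ _.
rewrite /gen; under eq_bigr => b _ do rewrite mulrCA mulr_sumr.
rewrite -mulr_sumr -mulrA; congr (_ * _); rewrite exchange_big /= /unit_count natr_sum mulr_suml.
apply: eq_bigr => u _; rewrite natr_sum mulr_suml.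
under eq_bigr => b _ do rewrite mulr_sumr.
rewrite exchange_big /=; apply: eq_bigr => v _.
set al := _ + _ * w; case: pselect => eal; last first.
  by rewrite mul0r; apply: big1 => b _; rewrite mulr0.
rewrite mul1r /Q.
rewrite -(sum_reps_act (P := fun b => psi p b * fa f N p (OmegaInv f p b) tau) hp ht eal); last first.
  move=> x y hx hy e; rewrite (fa_congr hp hx hy tau0 e); congr (_ * _).
  by rewrite (psiC pz hy e).
rewrite [LHS]big_seq [RHS]big_seq; apply: eq_bigr => b hb.
rewrite (act_OmegaInv hDneg hf hp) (psi_act hD hDneg hf hzs hchiu hcf hphi hpull pz (bt _ hb) eal).
by rewrite mulrCA mulrA.
Qed.

End Theta.

(** * Assembly of the two linear combinations *)

Theorem theorem3p3p4
  (R : realType)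
  (D : int) (hD : fund_disc D) (hDneg : D < 0)
  (f : nat) (hf : (0 < f)%N)
  (* z_1, ..., z_h with their primitive quadratic forms (a_z, b_z, c_z) *)
  (zs : seq (cmpt R))
  (hzs : forall p, p \in zs ->
     0 < cIm (cz p) /\ 0 < cA p /\ gcdz (gcdz (cA p) (cB p)) (cC p) = 1 /\
     (cA p)%:~R * cz p ^+ 2 + (cB p)%:~R * cz p + (cC p)%:~R = 0)
  (* the b_{z_a} represent the C-isomorphism classes of elliptic curves with CM by O_K *)
  (hCM : forall p, p \in zs -> CM_by_OK D (latt_z (cz p)))
  (hdistinct : forall i j, (i < size zs)%N -> (j < size zs)%N -> i <> j ->
     ~ homothetic (latt_z (cz (nth (CMpt 0 0 0 0) zs i))) (latt_z (cz (nth (CMpt 0 0 0 0) zs j))))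
  (hcomplete : forall L : set R[i], is_lattice L -> CM_by_OK D L ->
     exists2 p, p \in zs & homothetic L (latt_z (cz p)))
  (* chi, a character of (O_K / c)^x, c = f sqrt(D_K) O_K, with chi(u) = u on units *)
  (chi : R[i] -> R[i])
  (hchi : is_char_mod D (prin D (f%:R * sqrtD R D)) chi)
  (hchiu : forall u, unitOK D u -> chi u = u)
  (* phi, Hecke character of infinity type [-1/2;1,0] and conductor cf, cf | c *)
  (cf : set R[i]) (phi : set R[i] -> R[i]) (chi' : R[i] -> R[i])
  (hcf : prin D (f%:R * sqrtD R D) `<=` cf)
  (hphi : is_hecke D cf phi chi')
  (hpull : forall a, elt_coprime D (prin D (f%:R * sqrtD R D)) a -> chi' a = (chi a)^-1) :
  (* theta(.;phi) lies in F^{chi^-1}(f) = sum_a F_a^{chi^-1} *)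
  (exists L : seq (nat * (R * R) * R[i]),
     (forall q, q \in L -> (q.1.1 < size zs)%N /\
        in_dual f (nth (CMpt 0 0 0 0) zs q.1.1) q.1.2) /\
     forall tau : R[i], 0 < cIm tau ->
       ccvg (theta_partial D cf phi tau)
         (\sum_(q <- L) q.2 * gen D f (nth (CMpt 0 0 0 0) zs q.1.1) chi
                                  (prin D (f%:R * sqrtD R D)) q.1.2 tau)) /\
  (* theta(.;phi) = sum c_{a,beta} f_a(.;beta) with |c_{a,beta}| constant on nonzero ones *)
  (exists L : seq (nat * (R * R) * R[i]),
     (forall q, q \in L -> (q.1.1 < size zs)%N /\
        in_dual f (nth (CMpt 0 0 0 0) zs q.1.1) q.1.2) /\
     (forall i j : 'I_(size L), i <> j -> (nth (0%N, (0,0), 0) L i).1.1 = (nth (0%N, (0,0), 0) L j).1.1 ->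
        ~ same_coset (nth (0%N, (0,0), 0) L i).1.2 (nth (0%N, (0,0), 0) L j).1.2) /\
     (forall q1 q2, q1 \in L -> q2 \in L -> q1.2 != 0 -> q2.2 != 0 -> `|q1.2| = `|q2.2|) /\
     forall tau : R[i], 0 < cIm tau ->
       ccvg (theta_partial D cf phi tau)
         (\sum_(q <- L) q.2 * fa f (f * `|D|)%N (nth (CMpt 0 0 0 0) zs q.1.1) q.1.2 tau)).
Proof.
have hgood p : p \in zs -> CM_point D p.
  by move=> pz; have [h1 [h2 [h3 h4]]] := hzs p pz; split=> //; exact: hCM.
pose zn i := nth (CMpt 0 0 0 0) zs i.
have zn_in i : (i < size zs)%N -> zn i \in zs by exact: mem_nth.
have [U [uU mU]] := unit_seq R hD hDneg.
have hr i : exists t : seq R[i], (i < size zs)%N -> is_reps D f (zn i) t.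
  case: (boolP (i < size zs)%N) => [iz|_]; last by exists [::].
  by have [t ht] := coset_reps hD hDneg hf (hgood _ (zn_in i iz)); exists t.
have [rp hrp] := choice hr.
pose S : seq (nat * R[i]) := [seq (i, b) | i <- iota 0 (size zs), b <- rp i].
have mS e : e \in S -> (e.1 < size zs)%N /\ e.2 \in rp e.1.
  by move=> /allpairsPdep[i [b [iz bt ->]]]; move: iz; rewrite mem_iota.
have uS : uniq S.
  apply: allpairs_uniq_dep; rewrite ?iota_uniq //.
    by move=> i; rewrite mem_iota /= => iz; have [] := hrp i iz.
  by move=> [i x] [i' x'] _ _ /= [-> ->].
pose pt (e : nat * R[i]) := OmegaInv f (zn e.1) e.2.
(* The factor [kappa] appears because [fa] is built on [Omega' = Omega / kappa], and [size U]
   because each ideal is represented once per unit. *)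
pose co (e : nat * R[i]) := kappa f (zn e.1) * psi cf phi (zn e.1) e.2 / (size U)%:R.
have dual e : e \in S -> (e.1 < size zs)%N /\ in_dual f (zn e.1) (pt e).
  move=> /mS[iz et]; split=> //; apply: (in_dual_OmegaInv hDneg hf (hgood _ (zn_in _ iz))).
  by have [_ h _ _] := hrp _ iz; exact: h.
have lim tau : 0 < cIm tau -> ccvg (theta_partial D cf phi tau)
    (\sum_(i <- iota 0 (size zs)) \sum_(b <- rp i)
       co (i, b) * fa f (f * `|D|) (zn i) (pt (i, b)) tau).
  exact: (theta_limit hD hDneg hf hgood hdistinct hcomplete hchiu hcf hphi hpull uU mU hrp).
split.
(* The order of the CM group, by which averaging multiplies the sum; it is divided out of the
   coefficients. *)
- pose cnt : R[i] := (`|D|%:R)^-1 * (unit_count R D f)%:R.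
  have cnt0 : cnt != 0.
    rewrite mulf_neq0 // ?invr_eq0 pnatr_eq0 -lt0n ?(unit_count_gt0 R hD hDneg hf) //.
    by rewrite absz_gt0 lt_eqF.
  exists [seq (e.1, pt e, co e / cnt) | e <- S]; split.
    by move=> _ /mapP[e eS ->] /=; exact: dual.
  move=> tau tau0; rewrite big_map big_allpairs_dep /=.
  suff -> : \sum_(i <- iota 0 (size zs)) \sum_(b <- rp i) co (i, b) / cnt *
      gen D f (zn i) chi (prin D (f%:R * sqrtD R D)) (pt (i, b)) tau =
    \sum_(i <- iota 0 (size zs)) \sum_(b <- rp i)
       co (i, b) * fa f (f * `|D|) (zn i) (pt (i, b)) tau by exact: lim.
  rewrite [LHS]big_seq [RHS]big_seq; apply: eq_bigr => i; rewrite mem_iota => /= iz.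
  have key := sum_reps_gen hD hDneg hf hgood hchiu hcf hphi hpull iz (hrp i iz) tau0.
  transitivity (kappa f (zn i) / (size U)%:R / cnt * \sum_(b <- rp i) psi cf phi (zn i) b *
     gen D f (zn i) chi (prin D (f%:R * sqrtD R D)) (pt (i, b)) tau).
    by rewrite mulr_sumr; apply: eq_bigr => b _; rewrite /co /=; ring.
  have cancel (x c y : R[i]) : c != 0 -> x / c * (c * y) = x * y by move=> c0; rewrite mulrA divfK.
  rewrite key (cancel _ cnt) // mulr_sumr; apply: eq_bigr => b _.
  by rewrite /co /pt /=; ring.
- exists [seq (e.1, pt e, co e) | e <- S]; split; first by move=> _ /mapP[e eS ->] /=; exact: dual.
  split.
    move=> i j ij; have iS : (i < size S)%N by rewrite -(size_map (fun e => (e.1, pt e, co e))).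
    have jS : (j < size S)%N by rewrite -(size_map (fun e => (e.1, pt e, co e))).
    rewrite !(nth_map (0%N, 0)) //=; set e := nth _ S i; set e' := nth _ S j => ei.
    have eS : e \in S by exact: mem_nth.
    have eS' : e' \in S by exact: mem_nth.
    have [iz et] := mS e eS; have [iz' et'] := mS e' eS'.
    have hp := hgood _ (zn_in _ iz).
    rewrite /pt -ei => /(same_coset_Omega hDneg hf hp).
    rewrite !(OmegaInvK hDneg hf hp) => h; have [_ _ _ inj] := hrp _ iz.
    apply: ij; apply: val_inj; apply/eqP; rewrite -(nth_uniq (0%N, 0) iS jS uS); apply/eqP.
    rewrite -/e -/e'; have : e.2 = e'.2 by apply: inj => //; rewrite ei.
    by case: (e) (e') ei => a b [a' b'] /= -> ->.
  split.
    (* [|kappa|^2 |psi|^2 = |kappa|^2 A = f |D| / 2], whatever the CM point and the coset. *)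
    have nco e : e \in S -> co e != 0 ->
        nsq (co e) = f%:R * - D%:~R / 2 * (nsq ((size U)%:R : R[i]))^-1.
      move=> /mS[iz et] c0; have pz := zn_in _ iz; have hp := hgood _ pz.
      have [_ h _ _] := hrp _ iz.
      have psi0 : psi cf phi (zn e.1) e.2 != 0.
        by apply: contraNneq c0 => p0; rewrite /co p0 mulr0 mul0r.
      rewrite /co [LHS]nsqM nsqV nsqM; congr (_ * _).
      rewrite (nsq_psi hD hDneg hf hgood hcomplete hchiu hcf hphi hpull pz (h _ et) psi0).
      exact: (nsq_kappa hDneg hf hp).
    move=> _ _ /mapP[e eS ->] /mapP[e' eS' ->] /= c0 c0'.
    by apply: norm_nsq; rewrite (nco e) // (nco e').
  by move=> tau tau0; rewrite big_map big_allpairs_dep /=; exact: lim.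
Qed.
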